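(* Let $P$ be the uniform distribution on the closed unit disc $D=\{(x_1,x_2)\in\mathbb R^2: x_1^2+x_2^2\le 1\}$. Assume that every optimal set of four-means for $P$ is either the vertex set of a square centered at the origin, or consists of the origin together with the vertices of an equilateral triangle centered at the origin. Then there are uncountably many optimal sets of four-means for $P$, the quantization error is $V_4(P)=0.139747$ (decimal approximation, i.e. $|V_4(P)-0.139747|<10^{-6}$), and the four points of any optimal set of four-means form a square inscribed in the circle $x_1^2+x_2^2=\frac{32}{9\pi^2}$.
   Context: The uniform distribution on $D$ is the Borel probability measure with density $\frac1\pi$ on $D$ and $0$ elsewhere with respect to Lebesgue measure. For a Borel probability measure $P$ on $\mathbb R^d$ and $n\ge1$, the $n$th quantization error is $V_n(P)=\inf\{\int \min_{a\in\alpha}\|x-a\|^2\,dP(x):\alpha\subset\mathbb R^d,\ \mathrm{card}(\alpha)\le n\}$, where $\|\cdot\|$ is the Euclidean norm. A set $\alpha$ with $\mathrm{card}(\alpha)\le n$ attaining the infimum is called an optimal set of $n$-means; for absolutely continuous $P$ it has exactly $n$ elements. *)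

(* Defs.v *)
From HB Require Import structures.
From mathcomp Require Import all_boot all_order all_algebra finmap.
From mathcomp Require Import all_classical all_reals all_analysis.
Set Implicit Arguments.
Unset Strict Implicit.
Unset Printing Implicit Defensive.
Import Order.TTheory GRing.Theory Num.Theory.
Local Open Scope classical_set_scope.
Local Open Scope ring_scope.

(* The plane, whose product sigma-algebra is the Borel one. The norm that
   MathComp-Analysis puts on a product is the maximum norm, so the Euclidean
   norm is [enorm] below. *)
Notation plane R := (measurableTypeR R * measurableTypeR R)%type.

Section Plane.
Variable R : realType.
Implicit Types (x y z a b c d : plane R) (alpha : {fset plane R}).

Definition dotp x y : R := x.1 * y.1 + x.2 * y.2.

Definition enorm x : R := Num.sqrt (x.1 ^+ 2 + x.2 ^+ 2).

Definition unit_disc : set (plane R) := [set x | x.1 ^+ 2 + x.2 ^+ 2 <= 1].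

Definition disc_density x : R := pi^-1 * \1_unit_disc x.

Definition uniform_on_disc (P : probability (plane R) R) : Prop :=
  forall A : set (plane R), measurable A ->
    P A = (\int[@lebesgue_measure R \x @lebesgue_measure R]_(x in A)
            (disc_density x)%:E)%E.

Section Quantization.
Variable P : probability (plane R) R.

(* The minimum over the empty set is +oo, so the empty set never contributes to
   the infimum [quantization_error n] when n >= 1. *)
Definition distortion alpha : \bar R :=
  (\int[P]_x \big[Order.min/+oo]_(a <- alpha) (enorm (x - a) ^+ 2)%:E)%E.

Definition quantization_error (n : nat) : \bar R :=
  ereal_inf [set distortion alpha | alpha in [set alpha | (#|` alpha| <= n)%N]].

Definition optimal_means (n : nat) alpha : Prop :=
  (#|` alpha| <= n)%N /\ distortion alpha = quantization_error n.

End Quantization.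

(* a, b, c, d are the consecutive vertices of a nondegenerate square *)
Definition square a b c d : Prop :=
  [/\ 0 < enorm (b - a),
      [/\ enorm (c - b) = enorm (b - a),
          enorm (d - c) = enorm (b - a) &
          enorm (a - d) = enorm (b - a)] &
      [/\ dotp (b - a) (c - b) = 0, dotp (c - b) (d - c) = 0,
          dotp (d - c) (a - d) = 0 & dotp (a - d) (b - a) = 0]].

Definition equilateral_triangle a b c : Prop :=
  [/\ 0 < enorm (b - a), enorm (c - b) = enorm (b - a) &
      enorm (a - c) = enorm (b - a)].

Definition is_square alpha : Prop :=
  exists a b c d, square a b c d /\ alpha = [fset a; b; c; d]%fset.

(* In the next two definitions z is the center: the centroid of the vertices. *)
Definition is_square_centered_at z alpha : Prop :=
  exists a b c d,
    [/\ square a b c d, a + b + c + d = z *+ 4 & alpha = [fset a; b; c; d]%fset].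

Definition is_center_with_equilateral_triangle z alpha : Prop :=
  exists a b c,
    [/\ equilateral_triangle a b c, a + b + c = z *+ 3 &
        alpha = [fset z; a; b; c]%fset].

End Plane.

(* Main.v *)
(** A centred square of circumradius [r] has distortion
    1/2 + r^2 - 2 r E max(|p|, |q|), where p and q are the coordinates of the
    random point along the diagonals. Since 2 max(|p|, |q|) = |p + q| + |p - q|,
    rotation invariance reduces the expectation to E|x_1| = 4 / (3 pi); the
    quadratic is minimal at r = 4 sqrt 2 / (3 pi), with value 1/2 - 32 / (9 pi^2).

    The center with a triangle cannot compete: |x - r u|^2 >= |x|^2 - (x.u)^2 for
    every unit vector u, so its distortion is at least 1/2 - E m^2 where m is the
    largest of the three products x.u, and E m^2 is small enough, as one sees by
    integrating x_1^2 over a sector of 120 degrees with sqrt (1 - t) <= 1 - t / 2.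

    An optimal set exists by compactness, because moving the points to the nearest
    point of [-1, 1]^2 does not increase the distortion. It is therefore a square
    of the optimal radius; all its rotations are optimal too, and their first
    coordinates fill an interval. *)
Require Import Defs.
From mathcomp Require Import all_boot all_order all_algebra finmap.
From mathcomp Require Import all_classical all_reals all_analysis.
From mathcomp Require Import measurable_realfun ring lra.
Set Implicit Arguments.
Unset Strict Implicit.
Unset Printing Implicit Defensive.
Import Order.TTheory GRing.Theory Num.Theory.
Local Open Scope classical_set_scope.
Local Open Scope ring_scope.

(** * Integration over the disc *)

Section LebesguePlane.
Variable R : realType.
Local Notation mu := (@lebesgue_measure R).
Local Notation mu2 := (mu \x mu)%E.
Implicit Types f : plane R -> \bar R.

(** The image of Lebesgue measure under a translation gives half-open intervals their length, and
    this characterizes Lebesgue measure. *)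
Lemma ge0_integral_lebesgue_shift (f : R -> \bar R) (a : R) :
  measurable_fun setT f -> (forall x, (0 <= f x)%E) ->
  (\int[mu]_x f (x + a)%R = \int[mu]_x f x)%E.
Proof.
move=> mf f0.
pose phi : measurableTypeR R -> measurableTypeR R := fun x => x + a.
have mphi : measurable_fun setT phi by apply: measurable_funD.
rewrite [RHS](eq_measure_integral (pushforward mu phi)).
  by rewrite (ge0_integral_pushforward mphi).
move=> A mA _; apply: lebesgue_measure_unique => //= _ [[x y]] _ <-.
rewrite /pushforward/=.
have -> : phi @^-1` `]x, y]%classic = `]x - a, y - a]%classic.
  by apply/seteqP; split => z; rewrite /= !in_itv/= /phi ltrBlDr lerBrDr.
rewrite !lebesgue_measure_itv/= !lte_fin ltrD2r.
by case: ifP => // _; rewrite -!EFinB; congr (_%:E); ring.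
Qed.

(** By Tonelli with [x.2] fixed in the inner integral: there the shear is a translation. *)
Lemma ge0_integral_shear1 f (t : R) :
  measurable_fun setT f -> (forall x, (0 <= f x)%E) ->
  (\int[mu2]_x f (x.1 + t * x.2, x.2)%R = \int[mu2]_x f x)%E.
Proof.
move=> mf f0.
have mg : measurable_fun setT (fun x : plane R => f (x.1 + t * x.2, x.2)).
  apply: measurableT_comp => //; apply: measurable_fun_pair => //.
  by apply: measurable_funD => //; apply: measurable_funM.
rewrite !fubini_tonelli2//; apply: eq_integral => y _ /=.
rewrite /fubini_G/=.
apply: (@ge0_integral_lebesgue_shift (fun x => f (x, y))) => //.
by apply: measurableT_comp => //; apply: measurable_fun_pair.
Qed.

Lemma ge0_integral_shear2 f (t : R) :
  measurable_fun setT f -> (forall x, (0 <= f x)%E) ->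
  (\int[mu2]_x f (x.1, x.2 + t * x.1)%R = \int[mu2]_x f x)%E.
Proof.
move=> mf f0.
have mg : measurable_fun setT (fun x : plane R => f (x.1, x.2 + t * x.1)).
  apply: measurableT_comp => //; apply: measurable_fun_pair => //.
  by apply: measurable_funD => //; apply: measurable_funM.
rewrite !fubini_tonelli1//; apply: eq_integral => x _ /=.
rewrite /fubini_F/=.
apply: (@ge0_integral_lebesgue_shift (fun y => f (x, y))) => //.
by apply: measurableT_comp => //; apply: measurable_fun_pair.
Qed.

(* A rotation by an angle different from pi is a product of three shears, with
   parameters - tan (theta / 2), sin theta and - tan (theta / 2). *)
Lemma ge0_integral_rotation_neq f (c s : R) : c ^+ 2 + s ^+ 2 = 1 -> c != -1 ->
  measurable_fun setT f -> (forall x, (0 <= f x)%E) ->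
  (\int[mu2]_x f (c * x.1 - s * x.2, s * x.1 + c * x.2)%R = \int[mu2]_x f x)%E.
Proof.
move=> cs1 cN1 mf f0; pose t := - (s / (1 + c)).
have c1 : 1 + c != 0 by rewrite addrC addr_eq0.
have ms1 : measurable_fun setT (fun x : plane R => (x.1 + t * x.2, x.2) : plane R).
  apply: measurable_fun_pair => //.
  by apply: measurable_funD => //; apply: measurable_funM.
have ms2 : measurable_fun setT (fun x : plane R => (x.1, x.2 + s * x.1) : plane R).
  apply: measurable_fun_pair => //.
  by apply: measurable_funD => //; apply: measurable_funM.
pose f1 x := f (x.1 + t * x.2, x.2).
have mf1 : measurable_fun setT f1.
  exact: (measurableT_comp mf ms1).
pose f2 x := f1 (x.1, x.2 + s * x.1).
have mf2 : measurable_fun setT f2.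
  exact: (measurableT_comp mf1 ms2).
rewrite -[RHS](@ge0_integral_shear1 f t)//.
rewrite -[RHS](@ge0_integral_shear2 f1 s)//; last by move=> x; exact: f0.
rewrite -[RHS](@ge0_integral_shear1 f2 t)//; last by move=> x; exact: f0.
apply: eq_integral => -[x y] _; rewrite /f2 /f1/=.
(* The entries of the product of the three shears are [1 + s * t], equal to [c], and
   [2 t + s t^2 = t (1 + c)], equal to [- s]. *)
have es : s ^+ 2 = (1 - c) * (1 + c) by rewrite -(addrK (c ^+ 2) (s ^+ 2)) [s ^+ 2 + _]addrC cs1; ring.
have ec : 1 + s * t = c.
  by rewrite /t mulrN mulrA -expr2 es mulfK//; ring.
have tc : t * (1 + c) = - s by rewrite /t mulNr divfK.
have e2 : t + t * s * t + t = - s.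
  by rewrite -tc -[in RHS]ec; ring.
congr (f (_, _)).
  have -> : x + t * y + t * (y + s * (x + t * y)) =
    (1 + s * t) * x + (t + t * s * t + t) * y by ring.
  by rewrite ec e2; ring.
have -> : y + s * (x + t * y) = (1 + s * t) * y + s * x by ring.
by rewrite ec; ring.
Qed.

Lemma measurable_rotation (c s : R) : measurable_fun setT
  (fun x : plane R => (c * x.1 - s * x.2, s * x.1 + c * x.2) : plane R).
Proof.
apply: measurable_fun_pair.
- by apply: measurable_funB; apply: measurable_funM.
- by apply: measurable_funD; apply: measurable_funM.
Qed.

Lemma ge0_integral_rotation f (c s : R) : c ^+ 2 + s ^+ 2 = 1 ->
  measurable_fun setT f -> (forall x, (0 <= f x)%E) ->
  (\int[mu2]_x f (c * x.1 - s * x.2, s * x.1 + c * x.2)%R = \int[mu2]_x f x)%E.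
Proof.
move=> cs1 mf f0; have [c1|] := eqVneq c (-1); last first.
  by move=> ?; exact: ge0_integral_rotation_neq.
have s0 : s = 0.
  by apply/eqP; rewrite -sqrf_eq0; move: cs1; rewrite c1 => ?; apply/eqP; lra.
have q : (0 : R) ^+ 2 + 1 ^+ 2 = 1 by ring.
have N1 : (0 : R) != -1 by rewrite eq_sym oppr_eq0 oner_eq0.
(* The half turn is the square of the quarter turn [c = 0], [s = 1]. *)
rewrite -[RHS](@ge0_integral_rotation_neq f 0 1)//.
rewrite -[RHS](@ge0_integral_rotation_neq
  (fun x => f (0 * x.1 - 1 * x.2, 1 * x.1 + 0 * x.2)) 0 1)//.
  apply: eq_integral => -[x y] _ /=; rewrite c1 s0.
  by congr (f (_, _)); ring.
exact: (measurableT_comp mf (measurable_rotation 0 1)).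
Qed.

End LebesguePlane.

(** * Integrals against the uniform distribution and their slices *)

Section DiscIntegral.
Variable R : realType.
Local Notation mu := (@lebesgue_measure R).
Local Notation mu2 := (mu \x mu)%E.
Local Notation D := (@unit_disc R).
Implicit Types f : plane R -> \bar R.

Lemma measurable_sqnorm :
  measurable_fun [set: plane R] (fun x => x.1 ^+ 2 + x.2 ^+ 2 : R).
Proof. by apply: measurable_funD; apply: measurable_funX. Qed.

Lemma measurable_unit_disc : measurable D.
Proof.
rewrite (_ : D = setT `&` (fun x => x.1 ^+ 2 + x.2 ^+ 2) @^-1` `]-oo, 1]).
  by apply: measurable_sqnorm => //; exact: measurable_itv.
by rewrite setTI; apply/seteqP; split => x /=; rewrite in_itv.
Qed.

Lemma uniform_on_discE (P : probability (plane R) R) (A : set (plane R)) :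
  uniform_on_disc P -> measurable A -> (P A = pi^-1%:E * mu2 (D `&` A))%E.
Proof.
move=> PU mA; rewrite PU//.
under eq_integral do rewrite EFinM.
have mD1 : measurable_fun setT (fun x : plane R => (\1_D x : R)%:E).
  by apply/measurable_EFinP; apply: measurable_indic; exact: measurable_unit_disc.
rewrite ge0_integralZl_EFin//; last 2 first.
- exact: measurable_funTS.
- by rewrite invr_ge0 pi_ge0.
by rewrite integral_indic//; exact: measurable_unit_disc.
Qed.

(** [P] vanishes off the disc and is Lebesgue measure scaled by [pi^-1] on its measurable
    subsets. *)
Lemma ge0_integral_uniform (P : probability (plane R) R) f :
  uniform_on_disc P -> measurable_fun setT f -> (forall x, (0 <= f x)%E) ->
  (\int[P]_x f x = pi^-1%:E * \int[mu2]_(x in D) f x)%E.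
Proof.
move=> PU mf f0; have mD := measurable_unit_disc.
have PD : P (~` D) = 0%E.
  rewrite uniform_on_discE//; last exact: measurableC.
  by rewrite setICr measure0 mule0.
rewrite (ge0_negligible_integral (measurableC mD) measurableT mf (fun x _ => f0 x) PD).
rewrite setTD setCK.
have pi0 : 0 <= pi^-1 :> R by rewrite invr_ge0 pi_ge0.
rewrite (eq_measure_integral (mscale (NngNum pi0) mu2)); last first.
  by move=> A mA /setIidPr AD; rewrite [LHS](uniform_on_discE PU)// AD.
by rewrite ge0_integral_mscale//; exact: measurable_funTS.
Qed.

(** The disc is invariant under the rotation, so the integrand extended by zero can be rotated in
    the whole plane. *)
Lemma ge0_integral_uniform_rotation (P : probability (plane R) R) f (c s : R) :
  uniform_on_disc P -> c ^+ 2 + s ^+ 2 = 1 ->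
  measurable_fun setT f -> (forall x, (0 <= f x)%E) ->
  (\int[P]_x f (c * x.1 - s * x.2, s * x.1 + c * x.2)%R = \int[P]_x f x)%E.
Proof.
move=> PU cs1 mf f0; have mD := measurable_unit_disc.
have mrot := measurable_rotation c s.
rewrite !ge0_integral_uniform//; last exact: (measurableT_comp mf mrot).
congr (_ * _)%E; rewrite integral_mkcond [RHS]integral_mkcond.
rewrite -[RHS](ge0_integral_rotation cs1); last 2 first.
- by apply/(measurable_restrictT _ mD); exact: measurable_funTS.
- by move=> x; apply: erestrict_ge0.
apply: eq_integral => x _; rewrite !patchE.
suff -> : ((c * x.1 - s * x.2, s * x.1 + c * x.2) \in D) = (x \in D) by [].
apply/idP/idP; rewrite !inE /unit_disc/=.
- suff -> : (c * x.1 - s * x.2) ^+ 2 + (s * x.1 + c * x.2) ^+ 2 =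
    (c ^+ 2 + s ^+ 2) * (x.1 ^+ 2 + x.2 ^+ 2) by rewrite cs1 mul1r.
  by ring.
- suff -> : (c * x.1 - s * x.2) ^+ 2 + (s * x.1 + c * x.2) ^+ 2 =
    (c ^+ 2 + s ^+ 2) * (x.1 ^+ 2 + x.2 ^+ 2) by rewrite cs1 mul1r.
  by ring.
Qed.

Local Notation rad y := (Num.sqrt (1 - y ^+ 2)%R).

Lemma unit_disc_slice (x y : R) : y ^+ 2 <= 1 ->
  (x ^+ 2 + y ^+ 2 <= 1) = (- rad y <= x <= rad y).
Proof.
move=> y1; rewrite -ler_norml -sqrtr_sqr ler_sqrt ?subr_ge0//.
by rewrite lerBrDr.
Qed.

Lemma ge0_integral_unit_disc_slice (f : measurableTypeR R -> \bar R) (y : R) :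
  (\int[mu]_(x in [set x | (x ^+ 2 + y ^+ 2 <= 1)%R]) f x =
   \int[mu]_(x in `[(- rad y)%R, rad y]) f x)%E.
Proof.
have [y1|y1] := leP (y ^+ 2) 1.
  congr (integral _ _ _); apply/seteqP; split => x /=;
    by rewrite unit_disc_slice// in_itv.
(* For [|y| > 1] the slice is empty, while [rad y] is 0 because [Num.sqrt] is 0 on negative numbers;
   the interval is then a single point, of measure zero. *)
rewrite ler0_sqrtr; last by rewrite subr_le0 ltW.
rewrite oppr0 set_itv1 integral_set1.
rewrite (_ : [set x | _] = set0) ?integral_set0//.
apply/seteqP; split => x //=; apply/negP; rewrite -ltNge.
by rewrite (lt_le_trans y1)// lerDr sqr_ge0.
Qed.

(** The measurability of the inner integral is kept because constants have to be pulled out of the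
    outer one later. *)
Lemma fubini_tonelli_unit_disc2 f : measurable_fun setT f ->
  (forall x, (0 <= f x)%E) ->
  measurable_fun setT (fun y : measurableTypeR R =>
    \int[mu]_(x in `[(- rad y)%R, rad y]) f (x, y))%E /\
  (\int[mu2]_(x in D) f x =
   \int[mu]_y \int[mu]_(x in `[(- rad y)%R, rad y]) f (x, y))%E.
Proof.
move=> mf f0; have mD := measurable_unit_disc.
have mfD : measurable_fun setT (f \_ D).
  by apply/(measurable_restrictT _ mD); exact: measurable_funTS.
have fD0 x : (0 <= (f \_ D) x)%E by apply: erestrict_ge0.
have E y : (\int[mu]_x (f \_ D) (x, y) =
    \int[mu]_(x in `[(- rad y)%R, rad y]) f (x, y))%E.
  rewrite -ge0_integral_unit_disc_slice [RHS]integral_mkcond.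
  apply: eq_integral => x _; rewrite !patchE.
  by congr (if _ then _ else _); apply/idP/idP; rewrite !inE.
split; last first.
  rewrite integral_mkcond fubini_tonelli2//.
  by apply: eq_integral => y _; rewrite /fubini_G E.
under eq_fun do rewrite -E.
exact: (@measurable_fun_fubini_tonelli_G _ _ _ _ _ mu _ mfD fD0).
Qed.

Lemma fubini_tonelli_unit_disc1 f : measurable_fun setT f ->
  (forall x, (0 <= f x)%E) ->
  (\int[mu2]_(x in D) f x =
   \int[mu]_x \int[mu]_(y in `[(- rad x)%R, rad x]) f (x, y))%E.
Proof.
move=> mf f0; have mD := measurable_unit_disc.
have mfD : measurable_fun setT (f \_ D).
  by apply/(measurable_restrictT _ mD); exact: measurable_funTS.
have fD0 x : (0 <= (f \_ D) x)%E by apply: erestrict_ge0.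
rewrite integral_mkcond fubini_tonelli1//.
apply: eq_integral => x _; rewrite /fubini_F.
rewrite -ge0_integral_unit_disc_slice [RHS]integral_mkcond.
apply: eq_integral => y _; rewrite !patchE.
by congr (if _ then _ else _); apply/idP/idP; rewrite !inE/= /unit_disc/= addrC.
Qed.

Lemma ge0_integral_itv_even (f : R -> \bar R) (r : R) : 0 <= r ->
  measurable_fun setT f -> (forall x, - r <= x <= r -> (0 <= f x)%E) ->
  (forall x, f (- x) = f x) ->
  (\int[mu]_(x in `[(- r)%R, r]) f x = 2%:E * \int[mu]_(x in `[0%R, r]) f x)%E.
Proof.
move=> r0 mf f0 fN.
have sub : `[0, r]%classic `<=` `[- r, r]%classic.
  by apply: subset_itvr; rewrite bnd_simp oppr_le0.
(* The point 0 goes to the right half to make the union disjoint; it is put back into the left half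
   before reflecting, being negligible. *)
have -> : `[- r, r]%classic = `[- r, 0[%classic `|` `[0, r]%classic.
  apply/seteqP; split => x /=; rewrite !in_itv/=.
    by move=> /andP[-> ->]; have [?|?] := ltP x 0; [left|right].
  move=> [/andP[-> x0]|/andP[x0 ->]].
    by rewrite (le_trans (ltW x0)).
  by rewrite (le_trans _ x0)// oppr_le0.
have ABE : `[- r, 0[%classic `|` `[0, r]%classic `<=` `[- r, r]%classic.
  move=> x [|]; last exact: sub.
  by rewrite /= !in_itv/= => /andP[-> /ltW x0]; exact: le_trans x0 r0.
rewrite ge0_integral_setU//=; last 3 first.
- exact: measurable_funTS.
- by move=> x /ABE; rewrite /= in_itv/=; exact: f0.
- rewrite disj_set2E; apply/eqP/seteqP; split => x //=.
  by rewrite !in_itv/= => -[/andP[_ x0] /andP[]]; rewrite leNgt x0.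
rewrite integral_itv_bndo_bndc; last exact: measurable_funTS.
rewrite -[X in (2%:E * X)%E]mul1e muleA mule1 -[2]/(1 + 1) EFinD.
rewrite ge0_muleDl// mul1e; congr (_ + _)%E.
pose opp : measurableTypeR R -> measurableTypeR R := -%R.
have mopp : measurable_fun setT opp by exact: oppr_measurable.
rewrite [RHS](eq_measure_integral (pushforward mu opp)); last first.
  by move=> A mA _; exact/esym/lebesgue_measureN.
rewrite (ge0_integral_pushforward mopp)//; last 2 first.
- exact: measurable_funTS.
- by move=> x; rewrite inE => /sub; rewrite /= in_itv/=; exact: f0.
rewrite (_ : _ @^-1` _ = `[- r, 0]%classic).
  by apply: eq_integral => x _ /=; rewrite fN.
by apply/seteqP; split => x /=; rewrite !in_itv/= oppr_ge0 andbC lerNl.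
Qed.

End DiscIntegral.

(** * Moments of the uniform distribution on the disc *)

Section DiscMoments.
Import numFieldNormedType.Exports.
Variable R : realType.
Local Notation mu := (@lebesgue_measure R).
Local Notation mu2 := (mu \x mu)%E.
Local Notation D := (@unit_disc R).
Local Notation rad y := (Num.sqrt (1 - y ^+ 2)%R).

Lemma integral_itv_derive (f F : R -> R) (a b : R) : a <= b ->
  (forall x : R, derivable f x 1) -> (forall x : R, is_derive x 1 F (f x)) ->
  (\int[mu]_(x in `[a, b]) (f x)%:E = (F b - F a)%R%:E)%E.
Proof.
move=> + df dF; rewrite le_eqVlt => /predU1P[<-|ab].
  by rewrite set_itv1 integral_set1 subrr.
have cF x : {for x, continuous F}.
  by apply: differentiable_continuous; apply/derivable1_diffP; exact: ex_derive.
rewrite (@continuous_FTC2 _ f F)//.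
- apply: continuous_subspaceT => x.
  by apply: differentiable_continuous; exact/derivable1_diffP.
- split => [x _||]; first exact: ex_derive.
  + by apply: cvg_at_right_filter; exact: cF.
  + by apply: cvg_at_left_filter; exact: cF.
- by move=> x _; rewrite derive1E derive_val.
Qed.


Lemma integral_itv_sqr (a b : R) : a <= b ->
  (\int[mu]_(x in `[a, b]) (x ^+ 2)%:E = ((b ^+ 3 - a ^+ 3) / 3)%R%:E)%E.
Proof.
move=> ab; have dF (x : R) : is_derive x 1 (fun x => x ^+ 3 / 3) (x ^+ 2).
  by apply: is_derive_eq; rewrite /GRing.scale/=; field.
rewrite (integral_itv_derive ab _ dF)//.
by congr (_%:E); field.
Qed.

(** Inside the disc [rad y ^+ 2 = 1 - y ^+ 2]; outside, [rad y] is 0. *)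
Lemma rad_cube (y : R) : rad y ^+ 3 + y ^+ 2 * rad y = rad y.
Proof.
have [y1|y1] := leP (y ^+ 2) 1.
  by rewrite exprSr sqr_sqrtr ?subr_ge0//; ring.
by rewrite ler0_sqrtr ?subr_le0 ?(ltW y1)//; ring.
Qed.

Lemma measurable_rad : measurable_fun setT (fun x : measurableTypeR R => rad x).
Proof.
apply: (@measurableT_comp _ _ _ _ _ _ (@Num.sqrt R)).
  by apply: continuous_measurable_fun; exact: sqrt_continuous.
by apply: measurable_funB => //; exact: measurable_funX.
Qed.

Variable P : probability (plane R) R.
Hypothesis PU : uniform_on_disc P.

(* With A = \int rad = pi / 2 and B = \int x^2 rad (x), integrating x_1^2 first in
   x_2 gives 2 B and first in x_1 gives (2 / 3) (A - B). *)
Lemma integral_unit_disc_sqr :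
  (\int[mu2]_(x in D) (x.1 ^+ 2)%:E = (pi / 4)%:E)%E.
Proof.
have m1 : measurable_fun setT (fun x : plane R => (x.1 ^+ 2 : R)%:E).
  by apply/measurable_EFinP; exact: measurable_funX.
have f0 (x : plane R) : (0 <= (x.1 ^+ 2 : R)%:E)%E by rewrite lee_fin sqr_ge0.
have r0 (x : R) : 0 <= rad x by exact: sqrtr_ge0.
set S := LHS.
have S0 : (0 <= S)%E by apply: integral_ge0.
have ES1 : S = (\int[mu]_x (x ^+ 2 * (2 * rad x))%R%:E)%E.
  rewrite /S fubini_tonelli_unit_disc1//; apply: eq_integral => x _ /=.
  rewrite integral_cst//= lebesgue_measure_itv/= lte_fin.
  case: ifPn => [_|]; first by rewrite -EFinB -EFinM; congr (_%:E); ring.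
  rewrite -leNgt => h; have -> : rad x = 0 by apply/eqP; rewrite eq_le r0; lra.
  by rewrite mule0 !mulr0.
have ES2 : (3%:E * S = \int[mu]_x (2 * rad x ^+ 3)%R%:E)%E.
  rewrite /S (fubini_tonelli_unit_disc2 m1 f0).2 -ge0_integralZl_EFin//.
  - apply: eq_integral => y _; rewrite integral_itv_sqr; last by have := r0 y; lra.
    by rewrite -EFinM; congr (_%:E); field.
  - by move=> y _; apply: integral_ge0 => x _; exact: (f0 (x, y)).
  - exact: (fubini_tonelli_unit_disc2 m1 f0).1.
have Epi : (3%:E * S + S = pi%:E)%E.
  have m3 : measurable_fun setT (fun y : measurableTypeR R => (2 * rad y ^+ 3)%R%:E).
    apply/measurable_EFinP; apply: measurable_funM => //.
    by apply: measurable_funX; exact: measurable_rad.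
  have m4 : measurable_fun setT
      (fun y : measurableTypeR R => (y ^+ 2 * (2 * rad y))%R%:E).
    apply/measurable_EFinP; apply: measurable_funM => //.
    by apply: measurable_funM => //; exact: measurable_rad.
  have p3 (y : R) : setT y -> (0 <= (2 * rad y ^+ 3)%R%:E)%E.
    by rewrite lee_fin mulr_ge0// exprn_ge0.
  have p4 (y : R) : setT y -> (0 <= (y ^+ 2 * (2 * rad y))%R%:E)%E.
    by rewrite lee_fin mulr_ge0 ?sqr_ge0// mulr_ge0.
  rewrite ES2 [X in (_ + X)%E]ES1 -(ge0_integralD mu measurableT p3 m3 p4 m4).
  (* The area of the disc is [pi] because [P] has total mass 1. *)
  have := @ge0_integral_uniform _ _ (fun=> 1%E) PU (measurable_cst _) (fun=> @lee01 R).
  rewrite integral_cst//= mul1e probability_setT.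
  rewrite fubini_tonelli_unit_disc1//.
  move=> /(congr1 (fun z => pi%:E * z)%E); rewrite mule1 muleA -EFinM.
  rewrite mulfV ?gt_eqF ?pi_gt0// mul1e => ->.
  apply: eq_integral => x _; rewrite integral_cst//= lebesgue_measure_itv/= lte_fin.
  rewrite -EFinD.
  have -> : 2 * rad x ^+ 3 + x ^+ 2 * (2 * rad x) = 2 * rad x.
    by rewrite -[in RHS]rad_cube; ring.
  case: ifPn => [_|]; first by rewrite -EFinB -EFinM; congr (_%:E); ring.
  rewrite -leNgt => h; have -> : rad x = 0 by apply/eqP; rewrite eq_le r0; lra.
  by rewrite mule0 !mulr0.
move: S0 Epi; case: S {ES1 ES2} => [s|//|//] _; last first.
  by rewrite gt0_muley ?lte_fin.
rewrite -EFinM -EFinD => -[] sp; congr (_%:E).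
by apply/eqP; lra.
Qed.


Lemma mean_sqr1 : (\int[P]_x (x.1 ^+ 2)%:E = (4^-1)%:E)%E.
Proof.
rewrite (@ge0_integral_uniform _ _ (fun x => (x.1 ^+ 2)%:E))//.
- rewrite integral_unit_disc_sqr -EFinM; congr (_%:E).
  by move: (@pi_gt0 R); move: (@pi R) => p p0; field; rewrite gt_eqF.
- by apply/measurable_EFinP; exact: measurable_funX.
- by move=> x; rewrite lee_fin sqr_ge0.
Qed.

Lemma mean_sqnorm : (\int[P]_x (x.1 ^+ 2 + x.2 ^+ 2)%:E = (2^-1)%:E)%E.
Proof.
have m1 : measurable_fun setT (fun x : plane R => (x.1 ^+ 2 : R)%:E).
  by apply/measurable_EFinP; exact: measurable_funX.
have m2 : measurable_fun setT (fun x : plane R => (x.2 ^+ 2 : R)%:E).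
  by apply/measurable_EFinP; exact: measurable_funX.
under eq_integral do rewrite EFinD.
rewrite (ge0_integralD P measurableT _ m1 _ m2); last 2 first.
- by move=> x _; rewrite lee_fin sqr_ge0.
- by move=> x _; rewrite lee_fin sqr_ge0.
have -> : (\int[P]_x (x.2 ^+ 2)%:E = \int[P]_x (x.1 ^+ 2)%:E)%E.
  (* A quarter turn takes the first coordinate to the second. *)
  have cs : (0 : R) ^+ 2 + (-1) ^+ 2 = 1 by ring.
  rewrite -(ge0_integral_uniform_rotation PU cs m1); last first.
    by move=> x; rewrite lee_fin sqr_ge0.
  by apply: eq_integral => x _ /=; congr (_%:E); ring.
by rewrite mean_sqr1 -EFinD; congr (_%:E); field.
Qed.

(** The slice at height [y] contributes [rad y ^+ 2], which is [1 - y ^+ 2] on [-1, 1] and 0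
    elsewhere; the integral of this is 4/3. *)
Lemma mean_abs1 : (\int[P]_x (`|x.1|)%:E = (4 / (3 * pi))%:E)%E.
Proof.
have m1 : measurable_fun setT (fun x : plane R => (`|x.1| : R)%:E).
  by apply/measurable_EFinP; exact: measurableT_comp.
have f0 (x : plane R) : (0 <= (`|x.1| : R)%:E)%E by rewrite lee_fin.
have r0 (x : R) : 0 <= rad x by exact: sqrtr_ge0.
rewrite (ge0_integral_uniform PU m1 f0) (fubini_tonelli_unit_disc2 m1 f0).2.
have N11 : (-1 : R) <= 1 by rewrite ge0_cp.
have dX2 (x : R) : is_derive x 1 (fun x => x ^+ 2 / 2) x.
  by apply: is_derive_eq; rewrite /GRing.scale/=; field.
have slice (y : R) : (\int[mu]_(x in `[(- rad y)%R, rad y]) (`|x|)%:E =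
    (rad y ^+ 2)%:E)%E.
  rewrite (@ge0_integral_itv_even _ (fun x => (`|x|)%:E))//.
  - under eq_integral => x.
      rewrite inE/= in_itv/= => /andP[x0 _]; rewrite ger0_norm//; over.
    rewrite (integral_itv_derive (r0 y) _ dX2)// -EFinM.
    by congr (_%:E); field.
  - by apply/measurable_EFinP.
  - by move=> x; rewrite normrN.
have itv1 (y : R) : (y \in `[-1, 1]%classic) = (y ^+ 2 <= 1).
  by rewrite -(real_normK (num_real y)) expr_le1// ler_norml; apply/idP/idP; rewrite inE/= in_itv.
rewrite (_ : integral _ _ _ = \int[mu]_(y in `[(-1)%R, 1%R]) (1 - y ^+ 2)%R%:E)%E.
  have dF (y : R) : is_derive y 1 (fun y => y - y ^+ 3 / 3) (1 - y ^+ 2).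
    by apply: is_derive_eq; rewrite /GRing.scale/=; field.
  rewrite (integral_itv_derive N11 _ dF)//.
  rewrite -EFinM; congr (_%:E).
  by move: (@pi_gt0 R); move: (@pi R) => p p0; field; rewrite gt_eqF.
rewrite [RHS]integral_mkcond; apply: eq_integral => y _.
rewrite slice patchE itv1; case: leP => y1; first by rewrite sqr_sqrtr ?subr_ge0.
by rewrite ler0_sqrtr ?subr_le0 ?(ltW y1)// expr0n.
Qed.

End DiscMoments.

(** * Second moment of a sector of 120 degrees *)

Section SectorMoment.
Import numFieldNormedType.Exports.
Variable R : realType.
Local Notation mu := (@lebesgue_measure R).
Local Notation mu2 := (mu \x mu)%E.
Local Notation D := (@unit_disc R).
Local Notation rad y := (Num.sqrt (1 - y ^+ 2)%R).
Local Notation s3 := (Num.sqrt 3 : R)%R.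

(** The condition describes the sector of half-angle 60 degrees around the positive first axis. *)
Definition sector_sqr (x : plane R) : R :=
  if `|x.2| <= s3 * x.1 then x.1 ^+ 2 else 0.

Lemma sector_sqr_ge0 x : 0 <= sector_sqr x.
Proof. by rewrite /sector_sqr; case: ifP => // _; exact: sqr_ge0. Qed.

Lemma measurable_sector_sqr : measurable_fun setT sector_sqr.
Proof.
apply: measurable_fun_ifT => //; last exact: measurable_funX.
by apply: measurable_fun_ler; [exact: measurableT_comp|exact: measurable_funM].
Qed.

Let s3_gt0 : 0 < s3. Proof. by rewrite sqrtr_gt0. Qed.
Let s3_sqr : s3 ^+ 2 = 3. Proof. by rewrite sqr_sqrtr. Qed.

(** Upper bound for the slice integral at height [t]: that integral is
    [(rad t ^+ 3 - (t / s3) ^+ 3) / 3], and one factor [rad t] of the cube is replaced by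
    [1 - t ^+ 2 / 2]. A polynomial has an elementary primitive. *)
Let q (t : R) : R := ((1 - t ^+ 2) * (1 - t ^+ 2 / 2) - t ^+ 3 / (3 * s3)) / 3.

Let rad_le (y : R) : y ^+ 2 <= 1 -> rad y <= 1 - y ^+ 2 / 2.
Proof.
move=> y1; rewrite -(@ler_pXn2r _ 2)// ?nnegrE ?sqrtr_ge0//; last by lra.
by rewrite sqr_sqrtr ?subr_ge0//; have := sqr_ge0 (y ^+ 2); nra.
Qed.

(** The edges of the sector meet the circle at heights [s3 / 2] and [- (s3 / 2)]. Between them the
    slice of the sector inside the disc runs from [|y| / s3] to [rad y]. *)
Lemma sector_sqr_slice_in (y : R) : `|y| <= s3 / 2 ->
  (\int[mu]_(x in `[(- rad y)%R, rad y]) (sector_sqr (x, y))%:E <= (q `|y|)%:E)%E.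
Proof.
move=> yc; pose t := `|y| / s3.
have t0 : 0 <= t by rewrite divr_ge0// ltW.
have y2 : `|y| ^+ 2 <= 3 / 4.
  have -> : 3 / 4 = (s3 / 2) ^+ 2 :> R by rewrite expr_div_n s3_sqr; field.
  by rewrite ler_sqr ?nnegrE// divr_ge0// ltW.
have yy : `|y| ^+ 2 = y ^+ 2 by rewrite real_normK ?num_real.
have t2 : t ^+ 2 = `|y| ^+ 2 / 3 by rewrite expr_div_n s3_sqr.
have tr : t <= rad y.
  rewrite -(@ler_pXn2r _ 2)// ?nnegrE ?sqrtr_ge0// sqr_sqrtr; last by lra.
  by rewrite t2 yy; lra.
have -> : (\int[mu]_(x in `[(- rad y)%R, rad y]) (sector_sqr (x, y))%:E =
    \int[mu]_(x in `[t, rad y]) (x ^+ 2)%:E)%E.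
  rewrite [LHS]integral_mkcond [RHS]integral_mkcond; apply: eq_integral => x _.
  rewrite !patchE /sector_sqr/=.
  have -> : (x \in `[(- rad y)%R, rad y]%classic) = (- rad y <= x <= rad y).
    by apply/idP/idP; rewrite inE/= in_itv.
  have -> : (x \in `[t, rad y]%classic) = (t <= x <= rad y).
    by apply/idP/idP; rewrite inE/= in_itv.
  have -> : (`|y| <= s3 * x) = (t <= x) by rewrite /t ler_pdivrMr// mulrC.
  have [tx|xt] := leP t x; last by case: ifP.
  suff -> : - rad y <= x by [].
  by rewrite (le_trans _ (le_trans t0 tx))// oppr_le0 sqrtr_ge0.
rewrite integral_itv_sqr// lee_fin /q ler_pM2r ?invr_gt0//.
have -> : t ^+ 3 = `|y| ^+ 3 / (3 * s3).
  by rewrite [in LHS]exprS t2 /t exprS; field; rewrite gt_eqF.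
rewrite lerD2r yy exprS sqr_sqrtr; last by lra.
by rewrite mulrC ler_wpM2l//; [lra|apply: rad_le; lra].
Qed.

Lemma sector_sqr_slice_out (x y : R) : s3 / 2 < `|y| ->
  x <= rad y -> sector_sqr (x, y) = 0.
Proof.
move=> yc xr; rewrite /sector_sqr/=; case: ifPn => // h; exfalso.
have c0 : 0 < s3 / 2 by exact: divr_gt0.
have x0 : 0 < x.
  by rewrite -(pmulr_rgt0 _ s3_gt0); exact: lt_le_trans (lt_trans c0 yc) h.
have y2 : 3 / 4 < y ^+ 2.
  have -> : 3 / 4 = (s3 / 2) ^+ 2 :> R by rewrite expr_div_n s3_sqr; field.
  by rewrite -(real_normK (num_real y)) ltr_sqr ?nnegrE ?(ltW c0).
have r0 : 0 < rad y := lt_le_trans x0 xr.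
have x2 : x ^+ 2 <= 1 - y ^+ 2.
  rewrite -[leRHS]sqr_sqrtr; last by rewrite ltW// -sqrtr_gt0.
  by rewrite ler_sqr ?nnegrE// ltW.
(* With [x ^+ 2 <= 1 - y ^+ 2] this forces [y ^+ 2 <= 3 / 4]. *)
have : y ^+ 2 <= 3 * x ^+ 2.
  rewrite -s3_sqr -exprMn -(real_normK (num_real y)) ler_sqr ?nnegrE//.
  by rewrite mulr_ge0// ltW.
by lra.
Qed.

Variable P : probability (plane R) R.
Hypothesis PU : uniform_on_disc P.

Lemma mean_sector_sqr :
  (\int[P]_x (sector_sqr x)%:E <= (13 * s3 / (60 * pi))%:E)%E.
Proof.
have ms : measurable_fun setT (fun x => (sector_sqr x)%:E).
  by apply/measurable_EFinP; exact: measurable_sector_sqr.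
have s0 x : (0 <= (sector_sqr x)%:E)%E by rewrite lee_fin sector_sqr_ge0.
rewrite (ge0_integral_uniform PU ms s0).
have [mslice ->] := fubini_tonelli_unit_disc2 ms s0.
(* On this range the product in [q] is at least 1/4 * 5/8 = 5/32, and the subtracted term is at most
   1/8. *)
have q0 t : 0 <= t -> t <= s3 / 2 -> 0 <= q t.
  move=> t0 tc; rewrite /q divr_ge0//.
  have t2 : t ^+ 2 <= 3 / 4.
    have -> : 3 / 4 = (s3 / 2) ^+ 2 :> R by rewrite expr_div_n s3_sqr; field.
    by rewrite ler_sqr ?nnegrE// divr_ge0// ltW.
  have : t ^+ 3 / (3 * s3) <= 1 / 8.
    have -> : t ^+ 3 / (3 * s3) = t / s3 * (t ^+ 2 / 3).
      by rewrite [in LHS]exprS; field; rewrite gt_eqF.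
    have h : t / s3 <= 1 / 2 by rewrite ler_pdivrMr//; lra.
    have h0 : 0 <= t / s3 by rewrite divr_ge0// ltW.
    by have := sqr_ge0 t; nra.
  by have := sqr_ge0 t; nra.
have mq : measurable_fun setT (fun y : R => (q `|y|)%:E).
  apply/measurable_EFinP; apply: (@measurableT_comp _ _ _ _ _ _ q) => //.
  apply: continuous_measurable_fun => t.
  apply: differentiable_continuous; apply/derivable1_diffP.
  by rewrite /q; exact: ex_derive.
have c0 : 0 <= s3 / 2 by rewrite divr_ge0// ltW.
have -> : (13 * s3 / (60 * pi))%:E = (pi^-1%:E * (13 * s3 / 60)%:E)%E.
  rewrite -EFinM; congr (_%:E).
  by move: (@pi_gt0 R); move: (@pi R) => p p0; field; rewrite gt_eqF.
rewrite lee_wpmul2l ?lee_fin ?invr_ge0 ?pi_ge0//.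
pose g := (fun y : R => (q `|y|)%:E) \_ `[(- (s3 / 2))%R, s3 / 2].
apply: (@le_trans _ _ (\int[mu]_y g y)%E).
  apply: ge0_le_integral => //.
  - by move=> y _; apply: integral_ge0.
  - by apply/(measurable_restrictT _ (measurable_itv _)); exact: measurable_funTS.
  - move=> y _; rewrite /g patchE.
    have -> : (y \in `[(- (s3 / 2))%R, s3 / 2]%classic) = (`|y| <= s3 / 2).
      by rewrite ler_norml; apply/idP/idP; rewrite inE/= in_itv.
    case: (leP `|y| (s3 / 2)) => yc; first exact: sector_sqr_slice_in.
    rewrite integral0_eq// => x /=; rewrite in_itv/= => /andP[_ xr].
    by rewrite sector_sqr_slice_out.
rewrite /g -integral_mkcond.
have qc : (\int[mu]_(y in `[0%R, (s3 / 2)%R]) (q `|y|)%:E = (13 * s3 / 120)%R%:E)%E.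
  (* A primitive of [q], from [(1 - t^2) (1 - t^2 / 2) = 1 - 3 t^2 / 2 + t^4 / 2]. *)
  have dQ (t : R) : is_derive t 1 (fun t =>
      (t - t ^+ 3 / 2 + t ^+ 5 / 10 - t ^+ 4 / (12 * s3)) / 3) (q t).
    by apply: is_derive_eq; rewrite /q /GRing.scale/=; field; rewrite gt_eqF.
  under eq_integral => t.
    by rewrite inE/= in_itv/= => /andP[t0 _]; rewrite ger0_norm//; over.
  rewrite (integral_itv_derive c0 _ dQ); last by move=> t; rewrite /q.
  congr (_%:E).
  have -> : (s3 / 2) ^+ 4 / (12 * s3) = s3 * s3 ^+ 2 / 192.
    by field; rewrite gt_eqF.
  have -> : (s3 / 2) ^+ 5 = s3 * (s3 ^+ 2) ^+ 2 / 32 by field.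
  have -> : (s3 / 2) ^+ 3 = s3 * s3 ^+ 2 / 8 by field.
  by rewrite s3_sqr; field; rewrite gt_eqF.
rewrite (@ge0_integral_itv_even _ (fun y => (q `|y|)%:E) _ c0 mq) ?qc.
- by rewrite -EFinM lee_fin le_eqVlt; apply/orP; left; apply/eqP; field.
- by move=> y yc; rewrite lee_fin q0// ler_norml.
- by move=> y; rewrite normrN.
Qed.

End SectorMoment.

(** * Decimals of pi *)

Section PiBounds.
Import numFieldNormedType.Exports.
Variable R : realType.

Lemma ge0_of_ge0_derive (f f' : R -> R) : f 0 = 0 ->
  (forall x : R, is_derive x 1 f (f' x)) -> (forall x, 0 <= x -> 0 <= f' x) ->
  forall x, 0 <= x -> 0 <= f x.
Proof.
move=> f0 df f'0 x x0; rewrite -f0.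
apply: (@ger0_derive1_ndecry _ f 0) => //.
- move=> y; rewrite in_itv/= andbT => /ltW y0.
  by rewrite derive1E; case: (df y) => _ ->; exact: f'0.
- apply: continuous_subspaceT => y; apply: differentiable_continuous.
  by apply/derivable1_diffP; case: (df y).
Qed.

(** Here and in [cos_taylor], [n] counts the nonzero terms of the series and is not the degree. *)
Definition sin_taylor (n : nat) (x : R) : R :=
  \sum_(k < n) (-1) ^+ k * ((2 * k).+1`!%:R^-1 * x ^+ (2 * k).+1).

Definition cos_taylor (n : nat) (x : R) : R :=
  \sum_(k < n) (-1) ^+ k * ((2 * k)`!%:R^-1 * x ^+ (2 * k)).

Lemma is_derive_fact_exp (n : nat) (x : R) :
  is_derive x 1 (fun y : R => n.+1`!%:R^-1 * y ^+ n.+1) (n`!%:R^-1 * x ^+ n).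
Proof.
have <- : n.+1`!%:R^-1 * n.+1%:R = n`!%:R^-1 :> R.
  by rewrite factS natrM invfM mulrAC mulVf ?mul1r// pnatr_eq0.
move: (_^-1) => c.
rewrite (_ : (fun y : R => _) = c \*: (id ^+ n.+1)); last first.
  by apply/funext => y; rewrite /= exprfctE.
apply: is_derive_eq; rewrite /GRing.scale/=; ring.
Qed.

Lemma is_derive_sin_taylor (n : nat) (x : R) :
  is_derive x 1 (sin_taylor n) (cos_taylor n x).
Proof.
elim: n => [|n ih].
  have -> : sin_taylor 0 = cst 0 by apply/funext => y; rewrite /sin_taylor big_ord0.
  by rewrite /cos_taylor big_ord0; exact: is_derive_cst.
have -> : sin_taylor n.+1 = sin_taylor n \+
    (fun y => (-1) ^+ n *: ((2 * n).+1`!%:R^-1 * y ^+ (2 * n).+1)).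
  by apply/funext => y; rewrite /sin_taylor big_ord_recr.
rewrite /cos_taylor big_ord_recr; apply: is_deriveD; apply: is_deriveZ.
exact: is_derive_fact_exp.
Qed.

(** The index drops by one because the constant term of the cosine disappears. *)
Lemma is_derive_cos_taylor (n : nat) (x : R) :
  is_derive x 1 (cos_taylor n.+1) (- sin_taylor n x).
Proof.
elim: n => [|n ih].
  have -> : cos_taylor 1 = cst 1.
    apply/funext => y; rewrite /cos_taylor big_ord_recr big_ord0/= muln0 fact0.
    by rewrite expr0 invr1 !mulr1 add0r.
  by rewrite /sin_taylor big_ord0 oppr0; exact: is_derive_cst.
have -> : cos_taylor n.+2 = cos_taylor n.+1 \+
    (fun y => (-1) ^+ n.+1 *: ((2 * n.+1)`!%:R^-1 * y ^+ (2 * n.+1))).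
  by apply/funext => y; rewrite /cos_taylor big_ord_recr.
have h : is_derive x 1
    (fun y : R => (-1) ^+ n.+1 *: ((2 * n.+1)`!%:R^-1 * y ^+ (2 * n.+1)))
    ((-1) ^+ n.+1 *: ((2 * n).+1`!%:R^-1 * x ^+ (2 * n).+1)).
  by apply: is_deriveZ; rewrite mulnS; exact: is_derive_fact_exp.
rewrite /sin_taylor big_ord_recr opprD -[X in _ + X]mulNr.
rewrite -[X in _ + X * _]mulN1r -exprS.
exact: is_deriveD.
Qed.

(* The sign of the remainder propagates from cos to sin and back by integrating
   from 0, starting from cos <= 1. *)
Lemma taylor_remainder_sign (n : nat) :
  (forall x, 0 <= x -> 0 <= (-1) ^+ n.+1 * (cos x - cos_taylor n.+1 x)) /\
  (forall x, 0 <= x -> 0 <= (-1) ^+ n.+1 * (sin x - sin_taylor n.+1 x)).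
Proof.
have sin_step m : (forall x, 0 <= x -> 0 <= (-1) ^+ m * (cos x - cos_taylor m x)) ->
    forall x, 0 <= x -> 0 <= (-1) ^+ m * (sin x - sin_taylor m x).
  move=> h; have d (x : R) : is_derive x 1
      (fun x => (-1) ^+ m *: (sin x - sin_taylor m x))
      ((-1) ^+ m * (cos x - cos_taylor m x)).
    apply: is_deriveZ; apply: is_deriveB.
    exact: is_derive_sin_taylor.
  have e : (fun x => (-1) ^+ m *: (sin x - sin_taylor m x)) 0 = 0 :> R.
    rewrite sin0 sub0r /sin_taylor big1 ?oppr0 ?scaler0// => k _.
    by rewrite expr0n/= !mulr0.
  exact: (ge0_of_ge0_derive e d h).
elim: n => [|n [_ ihs]].
  suff h : forall x : R, 0 <= x -> 0 <= (-1) ^+ 1 * (cos x - cos_taylor 1 x).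
    by split => //; exact: sin_step.
  move=> x _; rewrite /cos_taylor big_ord_recr big_ord0/= muln0 fact0.
  by rewrite !expr0 invr1 !mulr1 add0r expr1 mulN1r opprB subr_ge0 cos_le1.
suff h : forall x : R, 0 <= x -> 0 <= (-1) ^+ n.+2 * (cos x - cos_taylor n.+2 x).
  by split => //; exact: sin_step.
have d (x : R) : is_derive x 1
    (fun x => (-1) ^+ n.+2 *: (cos x - cos_taylor n.+2 x))
    ((-1) ^+ n.+1 * (sin x - sin_taylor n.+1 x)).
  have h : is_derive x 1 (fun x => (-1) ^+ n.+2 *: (cos x - cos_taylor n.+2 x))
      ((-1) ^+ n.+2 *: (- sin x - - sin_taylor n.+1 x)).
    by apply: is_deriveZ; apply: is_deriveB; exact: is_derive_cos_taylor.
  move: h; rewrite [X in is_derive _ _ _ X -> _](_ : _ =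
    (-1) ^+ n.+1 * (sin x - sin_taylor n.+1 x))//.
  by rewrite /GRing.scale/= (exprS _ n.+1); ring.
have e : (fun x => (-1) ^+ n.+2 *: (cos x - cos_taylor n.+2 x)) 0 = 0 :> R.
  rewrite cos0 /cos_taylor big_ord_recl big1 => [|k _].
    by rewrite muln0 fact0 !expr0 invr1 !mulr1 addr0 subrr scaler0.
  by rewrite expr0n/= !mulr0.
exact: (ge0_of_ge0_derive e d ihs).
Qed.

(** The remainders after four and five terms have opposite signs; the last denominators are 7! and
    9! in factored form. *)
Lemma sin_taylor_le (x : R) : 0 <= x ->
  x - x ^+ 3 / 6 + x ^+ 5 / 120 - x ^+ 7 / (7 * 720) <= sin x /\
  sin x <= x - x ^+ 3 / 6 + x ^+ 5 / 120 - x ^+ 7 / (7 * 720)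
           + x ^+ 9 / (9 * (8 * (7 * 720))).
Proof.
move=> x0.
have f7 : 7`!%:R = 7 * 720 :> R by rewrite factS natrM.
have f9 : 9`!%:R = 9 * (8 * (7 * 720)) :> R by rewrite 2!factS 2!natrM f7.
have S n : sin_taylor n.+1 x =
    sin_taylor n x + (-1) ^+ n * ((2 * n).+1`!%:R^-1 * x ^+ (2 * n).+1).
  by rewrite /sin_taylor big_ord_recr.
have E4 : sin_taylor 4 x = x - x ^+ 3 / 6 + x ^+ 5 / 120 - x ^+ 7 / (7 * 720).
  rewrite !S -[(2 * 0).+1]/1%N -[(2 * 1).+1]/3%N -[(2 * 2).+1]/5%N.
  rewrite -[(2 * 3).+1]/7%N f7 -[1`!]/1%N -[3`!]/6%N -[5`!]/120%N.
  by rewrite {1}/sin_taylor big_ord0; lra.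
have E5 : sin_taylor 5 x = sin_taylor 4 x + x ^+ 9 / (9 * (8 * (7 * 720))).
  by rewrite S -[(2 * 4).+1]/9%N f9; congr (_ + _); lra.
rewrite -E4 -E5.
have [_ /(_ x x0)] := taylor_remainder_sign 3.
have [_ /(_ x x0)] := taylor_remainder_sign 4.
have -> : (-1) ^+ 5 = -1 :> R by ring.
have -> : (-1) ^+ 4 = 1 :> R by ring.
by rewrite mulN1r mul1r opprB !subr_ge0.
Qed.

(** The triple angle formula at [pi / 2] reads [3 s - 4 s^3 = 1], that is [(s + 1) (2 s - 1)^2 = 0],
    and [s] is nonnegative. *)
Lemma sin_pi6 : sin (pi / 6) = 1 / 2 :> R.
Proof.
set s := sin _; pose c : R := cos (pi / 6).
have cs : c ^+ 2 + s ^+ 2 = 1 by exact: cos2Dsin2.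
have pi0 := @pi_gt0 R.
have s0 : 0 <= s.
  by apply: sin_ge0_pi; move: pi0; move: (pi : R) => p p0; apply/andP; split; lra.
have : sin (pi / 2) = 1 :> R := sin_pihalf R.
have -> : pi / 2 = pi / 6 + pi / 6 + pi / 6 :> R.
  by move: (pi : R) => p; lra.
rewrite !(sinD, cosD) -/s -/c => h.
have {}h : (s + 1) * (2 * s - 1) ^+ 2 = 0.
  have -> : (s + 1) * (2 * s - 1) ^+ 2 = 1 -
    ((s * c + c * s) * c + (c * c - s * s) * s) + 3 * s * (c ^+ 2 + s ^+ 2 - 1).
    by ring.
  by rewrite h cs; ring.
move/eqP: h; rewrite mulf_eq0 sqrf_eq0 => /orP[]/eqP h; lra.
Qed.

(** [b] is one sixth of the bound. If [pi] reached the bound, monotonicity would give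
    [sin b <= 1 / 2], against the lower Taylor bound. [pi_gt] is dual, with the upper Taylor
    bound. *)
Lemma pi_lt : pi < 3 + 141 / 10 ^+ 3 + 594 / 10 ^+ 6 :> R.
Proof.
pose b : R := 523 / 10 ^+ 3 + 599 / 10 ^+ 6.
rewrite ltNge; apply/negP => h.
have b0 : 0 <= b by rewrite /b; lra.
have [+ _] := sin_taylor_le b0.
have : sin b <= sin (pi / 6).
  have pi4 : pi <= 4 :> R by have := @pihalf_02 R; lra.
  move: h pi4; rewrite /b; set p : R := pi => h pi4.
  have b6 : 523 / 10 ^+ 3 + 599 / 10 ^+ 6 <= p / 6 by lra.
  by rewrite leNgt ltr_sin -?leNgt// in_itv/= -/p; apply/andP; split; lra.
rewrite sin_pi6 /b; lra.
Qed.

Lemma pi_gt : 3 + 141 / 10 ^+ 3 + 591 / 10 ^+ 6 < pi :> R.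
Proof.
pose b : R := 523 / 10 ^+ 3 + 598 / 10 ^+ 6 + 5 / 10 ^+ 7.
rewrite ltNge; apply/negP => h.
have b0 : 0 <= b by rewrite /b; lra.
have [_] := sin_taylor_le b0.
have : sin (pi / 6) <= sin b.
  have pi2 : 2 <= pi :> R := @pi_ge2 R.
  move: h pi2; rewrite /b; set p : R := pi => h pi2.
  by rewrite leNgt ltr_sin -?leNgt ?in_itv/= -/p;
    [lra | apply/andP; split; lra..].
rewrite sin_pi6 /b; lra.
Qed.

End PiBounds.

(** * Distortion of the two shapes *)

Section Distortion.
Variable R : realType.
Implicit Types (x a b c d : plane R) (alpha : {fset plane R}).

Lemma enorm_sqr x : enorm x ^+ 2 = x.1 ^+ 2 + x.2 ^+ 2.
Proof. by rewrite sqr_sqrtr// addr_ge0// sqr_ge0. Qed.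

Lemma enorm_subr_sqr x a :
  enorm (x - a) ^+ 2 = (x.1 - a.1) ^+ 2 + (x.2 - a.2) ^+ 2.
Proof. by rewrite enorm_sqr. Qed.

Lemma le_bigmin_pinfty (T : eqType) (s : seq T) (F : T -> \bar R) (m : \bar R) :
  (forall t, t \in s -> (m <= F t)%E) ->
  (m <= \big[Order.min/+oo]_(t <- s) F t)%E.
Proof.
move=> h; rewrite big_seq; elim/big_ind : _ => //; first exact: leey.
by move=> y z my mz; rewrite le_min my.
Qed.

Lemma bigmin_pinfty_le (T : eqType) (s : seq T) (F : T -> \bar R) (t : T) :
  t \in s -> (\big[Order.min/+oo]_(u <- s) F u <= F t)%E.
Proof.
elim: s => // u s ih; rewrite inE big_cons ge_min => /predU1P[->|/ih ->].
  by rewrite lexx.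
by rewrite orbT.
Qed.

Definition sqdist_set alpha x : \bar R :=
  \big[Order.min/+oo%E]_(a <- alpha) (enorm (x - a) ^+ 2)%:E.

Lemma sqdist_set_ge0 alpha x : (0 <= sqdist_set alpha x)%E.
Proof. by apply: le_bigmin_pinfty => a _; rewrite lee_fin sqr_ge0. Qed.

Lemma sqdist_set_eq alpha x a m : a \in alpha -> enorm (x - a) ^+ 2 = m ->
  (forall b, b \in alpha -> m <= enorm (x - b) ^+ 2) ->
  sqdist_set alpha x = m%:E.
Proof.
move=> aalpha am h; apply/eqP; rewrite eq_le; apply/andP; split.
  by rewrite -am; exact: (bigmin_pinfty_le (fun a => (enorm (x - a) ^+ 2)%:E)).
by apply: le_bigmin_pinfty => b ?; rewrite lee_fin h.
Qed.

Lemma measurable_enorm_subr_sqr a :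
  measurable_fun setT (fun x => enorm (x - a) ^+ 2).
Proof.
under eq_fun do rewrite enorm_subr_sqr.
by apply: measurable_funD; apply: measurable_funX; apply: measurable_funB.
Qed.

Lemma measurable_sqdist_set alpha : measurable_fun setT (sqdist_set alpha).
Proof.
rewrite /sqdist_set; elim: (enum_fset alpha) => [|a s ih].
  by under eq_fun do rewrite big_nil; exact: measurable_cst.
under eq_fun do rewrite big_cons.
apply: measurable_mine => //.
by apply/measurable_EFinP; exact: measurable_enorm_subr_sqr.
Qed.

(** The vertices are [a], its opposite and its two quarter turns; [r] is the length of [a] and
    [(t1, t2)] its direction. *)
Lemma square_centered0 alpha : is_square_centered_at 0 alpha ->
  exists r t1 t2, [/\ 0 < r, t1 ^+ 2 + t2 ^+ 2 = 1 &
    forall x, (x \in alpha) = [|| x == (r * t1, r * t2), x == (- (r * t2), r * t1),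
      x == (- (r * t1), - (r * t2)) | x == (r * t2, - (r * t1))]].
Proof.
move=> [a [b [c [d [[]]]]]].
have sq (u v : plane R) : enorm u = enorm v ->
    u.1 ^+ 2 + u.2 ^+ 2 = v.1 ^+ 2 + v.2 ^+ 2 :> R.
  by move=> h; have := congr1 (fun z => z ^+ 2) h; rewrite !enorm_sqr.
move=> ab0 [/sq + /sq + /sq +] [+ + + +] + ->.
have {}ab0 : 0 < enorm (b - a) ^+ 2 by rewrite exprn_gt0.
rewrite enorm_sqr in ab0.
rewrite mul0rn; move: a b c d ab0 => [a1 a2] [b1 b2] [c1 c2] [d1 d2].
rewrite /dotp/= => ab0 e1 e2 e3 o1 o2 o3 o4 [s1 s2].
(* Opposite sides are opposite vectors: expanding the squared norm of their sum, with the four sides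
   adding up to 0, leaves only terms that vanish. *)
have f1 : (d1 - c1) = - (b1 - a1) /\ (d2 - c2) = - (b2 - a2).
  suff : (d1 - c1 + (b1 - a1)) ^+ 2 + (d2 - c2 + (b2 - a2)) ^+ 2 = 0.
    by move=> /eqP; rewrite paddr_eq0 ?sqr_ge0// !sqrf_eq0 !addr_eq0
      => /andP[/eqP ? /eqP ?].
  have -> : (d1 - c1 + (b1 - a1)) ^+ 2 + (d2 - c2 + (b2 - a2)) ^+ 2 =
    ((d1 - c1) ^+ 2 + (d2 - c2) ^+ 2) - ((b1 - a1) ^+ 2 + (b2 - a2) ^+ 2)
    - 2 * (((b1 - a1) * (c1 - b1) + (b2 - a2) * (c2 - b2))
      + ((a1 - d1) * (b1 - a1) + (a2 - d2) * (b2 - a2))) by ring.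
  by rewrite o1 o4 e2; ring.
have [c1E c2E] : c1 = - a1 /\ c2 = - a2 by split; lra.
have [d1E d2E] : d1 = - b1 /\ d2 = - b2 by split; lra.
subst c1 c2 d1 d2.
have eab : b1 ^+ 2 + b2 ^+ 2 = a1 ^+ 2 + a2 ^+ 2 by nra.
have oab : a1 * b1 + a2 * b2 = 0 by nra.
pose r := Num.sqrt (a1 ^+ 2 + a2 ^+ 2).
have r2 : r ^+ 2 = a1 ^+ 2 + a2 ^+ 2 by rewrite sqr_sqrtr ?addr_ge0 ?sqr_ge0.
have r0 : 0 < r by rewrite sqrtr_gt0; nra.
have rn0 : r != 0 by rewrite gt_eqF.
exists r, (a1 / r), (a2 / r); split => //.
  by rewrite !expr_div_n -mulrDl -r2 divff// expf_neq0.
have -> : r * (a1 / r) = a1 by rewrite mulrC divfK.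
have -> : r * (a2 / r) = a2 by rewrite mulrC divfK.
(* By Lagrange's identity the cross product of [a] and [b] is [r ^+ 2] up to sign; the sign is the
   orientation, and reversing it only permutes the vertices. *)
have : (a1 * b2 - a2 * b1 - r ^+ 2) * (a1 * b2 - a2 * b1 + r ^+ 2) = 0.
  have -> : (a1 * b2 - a2 * b1 - r ^+ 2) * (a1 * b2 - a2 * b1 + r ^+ 2) =
    (a1 ^+ 2 + a2 ^+ 2) * (b1 ^+ 2 + b2 ^+ 2) - (a1 * b1 + a2 * b2) ^+ 2
    - (r ^+ 2) ^+ 2 by ring.
  by rewrite eab oab r2; ring.
(* Expansion of [b] in the orthogonal frame of [a] and its quarter turn. *)
have bE1 : b1 * r ^+ 2 = - a2 * (a1 * b2 - a2 * b1) + a1 * (a1 * b1 + a2 * b2).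
  by rewrite r2; ring.
have bE2 : b2 * r ^+ 2 = a1 * (a1 * b2 - a2 * b1) + a2 * (a1 * b1 + a2 * b2).
  by rewrite r2; ring.
rewrite oab mulr0 addr0 in bE1; rewrite oab mulr0 addr0 in bE2.
have rr0 : r ^+ 2 != 0 by rewrite expf_neq0.
move/eqP; rewrite mulf_eq0 => /orP[/eqP|/eqP] /eqP.
- rewrite subr_eq0 => /eqP h; rewrite h in bE1 bE2.
  have -> : b1 = - a2 by apply: (mulIf rr0).
  have -> : b2 = a1 by apply: (mulIf rr0).
  by move=> x; rewrite !inE -!orbA opprK.
- rewrite addr_eq0 => /eqP h; rewrite h in bE1 bE2.
  have -> : b1 = a2 by apply: (mulIf rr0); rewrite bE1; ring.
  have -> : b2 = - a1 by apply: (mulIf rr0); rewrite bE2; ring.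
  move=> x; rewrite !inE -!orbA !opprK.
  by do 4!case: (x == _).
Qed.

Variable P : probability (plane R) R.
Hypothesis PU : uniform_on_disc P.

(** A linear form with unit coefficient vector is the first coordinate of the rotated point. *)
Lemma mean_abs_rotation t1 t2 : t1 ^+ 2 + t2 ^+ 2 = 1 ->
  (\int[P]_x (`|t1 * x.1 + t2 * x.2|)%:E = (4 / (3 * pi))%:E)%E.
Proof.
move=> t12; have cs : t1 ^+ 2 + (- t2) ^+ 2 = 1 by rewrite sqrrN.
have m1 : measurable_fun setT (fun x : plane R => (`|x.1| : R)%:E).
  by apply/measurable_EFinP; exact: measurableT_comp.
rewrite -(mean_abs1 PU) -(ge0_integral_uniform_rotation PU cs m1).
  by apply: eq_integral => x _ /=; rewrite mulNr opprK.
by move=> x; rewrite lee_fin.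
Qed.

Lemma distortion_square alpha r t1 t2 : 0 < r -> t1 ^+ 2 + t2 ^+ 2 = 1 ->
  (forall x, (x \in alpha) = [|| x == (r * t1, r * t2), x == (- (r * t2), r * t1),
      x == (- (r * t1), - (r * t2)) | x == (r * t2, - (r * t1))]) ->
  distortion P alpha = (2^-1 + r ^+ 2 - 8 * Num.sqrt 2 / (3 * pi) * r)%:E.
Proof.
move=> r0 t12 alphaE.
pose s2 : R := Num.sqrt 2; have s20 : 0 < s2 by rewrite sqrtr_gt0.
have s2n0 : s2 != 0 by rewrite gt_eqF.
have s2sq : s2 ^+ 2 = 2 by rewrite sqr_sqrtr.
(* [u] and [v] are p + q and p - q for the coordinates p, q along the diagonals; each is [s2] times
   a unit linear form. *)
pose u x : R := (t1 - t2) * x.1 + (t1 + t2) * x.2.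
pose v x : R := (t1 + t2) * x.1 + (t2 - t1) * x.2.
have mu : measurable_fun setT u.
  by apply: measurable_funD; apply: measurable_funM.
have mv : measurable_fun setT v.
  by apply: measurable_funD; apply: measurable_funM.
have Eu : (\int[P]_x (`|u x|)%:E = (s2 * (4 / (3 * pi)))%:E)%E.
  have q : ((t1 - t2) / s2) ^+ 2 + ((t1 + t2) / s2) ^+ 2 = 1.
    rewrite !expr_div_n s2sq -mulrDl.
    have -> : (t1 - t2) ^+ 2 + (t1 + t2) ^+ 2 = 2 * (t1 ^+ 2 + t2 ^+ 2) by ring.
    by rewrite t12 mulr1 divff.
  rewrite EFinM -(mean_abs_rotation q) -ge0_integralZl_EFin//.
  - apply: eq_integral => x _; rewrite -EFinM; congr (_%:E).
    have -> : u x = s2 * ((t1 - t2) / s2 * x.1 + (t1 + t2) / s2 * x.2) by rewrite /u; field.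
    by rewrite normrM gtr0_norm.
  - apply/measurable_EFinP; apply: measurableT_comp => //.
    by apply: measurable_funD; apply: measurable_funM.
  - exact: ltW.
have Ev : (\int[P]_x (`|v x|)%:E = (s2 * (4 / (3 * pi)))%:E)%E.
  have q : ((t1 + t2) / s2) ^+ 2 + ((t2 - t1) / s2) ^+ 2 = 1.
    rewrite !expr_div_n s2sq -mulrDl.
    have -> : (t1 + t2) ^+ 2 + (t2 - t1) ^+ 2 = 2 * (t1 ^+ 2 + t2 ^+ 2) by ring.
    by rewrite t12 mulr1 divff.
  rewrite EFinM -(mean_abs_rotation q) -ge0_integralZl_EFin//.
  - apply: eq_integral => x _; rewrite -EFinM; congr (_%:E).
    have -> : v x = s2 * ((t1 + t2) / s2 * x.1 + (t2 - t1) / s2 * x.2) by rewrite /v; field.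
    by rewrite normrM gtr0_norm.
  - apply/measurable_EFinP; apply: measurableT_comp => //.
    by apply: measurable_funD; apply: measurable_funM.
  - exact: ltW.
pose w x : R := r * (`|u x| + `|v x|).
have w0 x : 0 <= w x by rewrite mulr_ge0 ?(ltW r0)// addr_ge0.
have mw : measurable_fun setT w.
  by apply: measurable_funM => //; apply: measurable_funD; apply: measurableT_comp.
have Ew : (\int[P]_x (w x)%:E = (8 * s2 / (3 * pi) * r)%:E)%E.
  rewrite (_ : (fun x => _) = (fun x => r%:E * ((`|u x|)%:E + (`|v x|)%:E))%E); last first.
    by apply/funext => x; rewrite -EFinD -EFinM.
  have mau : measurable_fun setT (fun x => (`|u x|)%:E).
    by apply/measurable_EFinP; exact: measurableT_comp.
  have mav : measurable_fun setT (fun x => (`|v x|)%:E).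
    by apply/measurable_EFinP; exact: measurableT_comp.
  rewrite ge0_integralZl_EFin//; last 3 first.
  - by move=> x _; rewrite -EFinD lee_fin addr_ge0.
  - exact: emeasurable_funD.
  - exact: ltW.
  rewrite ge0_integralD//.
  rewrite Eu Ev -EFinD -EFinM; congr (_%:E).
  by move: (@pi_gt0 R); move: (@pi R) => p p0; field; rewrite gt_eqF.
(* [w x] is 2 r max(|p|, |q|), and the signs of [u x] and [v x] tell which vertex is nearest. The
   term stays on the left so that all integrands are nonnegative. *)
have pointwise x : (sqdist_set alpha x + (w x)%:E =
    (x.1 ^+ 2 + x.2 ^+ 2 + r ^+ 2)%:E)%E.
  rewrite (@sqdist_set_eq alpha x
    (if 0 <= u x then if 0 <= v x then (r * t1, r * t2) else (- (r * t2), r * t1)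
     else if 0 <= v x then (r * t2, - (r * t1)) else (- (r * t1), - (r * t2)))
    (x.1 ^+ 2 + x.2 ^+ 2 + r ^+ 2 - w x)); first by rewrite -EFinD subrK.
  - by rewrite alphaE; do 2 case: ifP => _; rewrite eqxx ?orbT.
  - rewrite enorm_subr_sqr -[r ^+ 2]mulr1 -t12 /w.
    case: (lerP 0 (u x)) => hu; [rewrite (ger0_norm hu)|rewrite (ltr0_norm hu)];
    (case: (lerP 0 (v x)) => hv; [rewrite (ger0_norm hv)|rewrite (ltr0_norm hv)]);
    by rewrite /u /v/=; ring.
  - move=> b; rewrite enorm_subr_sqr -[r ^+ 2]mulr1 -t12 /w alphaE.
    have [] := (ler_norm (u x), ler_norm (v x)).
    have [] := (ler_norm (- u x), ler_norm (- v x)); rewrite !normrN.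
    move: (`|u x|) (`|v x|) => U V; rewrite /u /v => h1 h2 h3 h4.
    by case/or4P => /eqP -> /=; move: x.1 x.2 h1 h2 h3 h4 => x1 x2 h1 h2 h3 h4; nra.
have mN := measurable_sqdist_set alpha.
have mwE : measurable_fun setT (fun x => (w x)%:E) by exact/measurable_EFinP.
have : (distortion P alpha + (8 * s2 / (3 * pi) * r)%:E = (2^-1 + r ^+ 2)%:E)%E.
  have w0E x : setT x -> (0 <= (w x)%:E)%E by rewrite lee_fin.
  rewrite -Ew -[distortion P alpha]/(\int[P]_x sqdist_set alpha x)%E.
  rewrite -(ge0_integralD P measurableT (fun x _ => sqdist_set_ge0 alpha x) mN w0E mwE).
  rewrite (eq_integral (fun x => ((x.1 ^+ 2 + x.2 ^+ 2)%:E + (r ^+ 2)%:E)%E)).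
    rewrite ge0_integralD//.
    - by rewrite mean_sqnorm// integral_cst//= probability_setT mule1.
    - by move=> x _; rewrite lee_fin addr_ge0 ?sqr_ge0.
    - by apply/measurable_EFinP; exact: measurable_sqnorm.
    - by move=> x _; rewrite lee_fin sqr_ge0.
  by move=> x _; exact: pointwise.
have : (0 <= distortion P alpha)%E.
  by apply: integral_ge0 => x _; exact: sqdist_set_ge0.
case: (distortion P alpha) => // z _ [] h; congr (_%:E).
by apply/eqP; rewrite -h addrK.
Qed.

End Distortion.

(** * Lower bound for the center with an equilateral triangle *)

Section Triangle.
Variable R : realType.
Implicit Types (x a b c d : plane R) (alpha : {fset plane R}).
Local Notation s3 := (Num.sqrt 3 : R)%R.

Let s3_gt0 : 0 < s3. Proof. by rewrite sqrtr_gt0. Qed.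
Let s3_sqr : s3 ^+ 2 = 3. Proof. by rewrite sqr_sqrtr. Qed.

Lemma center_triangle0 alpha : is_center_with_equilateral_triangle 0 alpha ->
  exists r t1 t2, [/\ 0 < r, t1 ^+ 2 + t2 ^+ 2 = 1 &
    forall x, x \in alpha -> [\/ x = (0, 0), x = (r * t1, r * t2),
      x = (r * (- t1 / 2 - s3 / 2 * t2), r * (- t2 / 2 + s3 / 2 * t1)) |
      x = (r * (- t1 / 2 + s3 / 2 * t2), r * (- t2 / 2 - s3 / 2 * t1))]].
Proof.
move=> [a [b [c [[]]]]].
have sq (u v : plane R) : enorm u = enorm v ->
    u.1 ^+ 2 + u.2 ^+ 2 = v.1 ^+ 2 + v.2 ^+ 2 :> R.
  by move=> h; have := congr1 (fun z => z ^+ 2) h; rewrite !enorm_sqr.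
move=> ab0 /sq + /sq + + ->.
have {}ab0 : 0 < enorm (b - a) ^+ 2 by rewrite exprn_gt0.
rewrite enorm_sqr in ab0.
rewrite mul0rn; move: a b c ab0 => [a1 a2] [b1 b2] [c1 c2] /=.
move=> ab0 e1 e2 [s1 s2].
have [c1E c2E] : c1 = - a1 - b1 /\ c2 = - a2 - b2 by split; lra.
subst c1 c2.
have oab : a1 * b1 + a2 * b2 = - (a1 ^+ 2 + a2 ^+ 2) / 2 by nra.
have eab : b1 ^+ 2 + b2 ^+ 2 = a1 ^+ 2 + a2 ^+ 2 by nra.
pose r := Num.sqrt (a1 ^+ 2 + a2 ^+ 2).
have r2 : r ^+ 2 = a1 ^+ 2 + a2 ^+ 2 by rewrite sqr_sqrtr ?addr_ge0 ?sqr_ge0.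
have r0 : 0 < r by rewrite sqrtr_gt0; nra.
have rn0 : r != 0 by rewrite gt_eqF.
exists r, (a1 / r), (a2 / r); split => //.
  by rewrite !expr_div_n -mulrDl -r2 divff// expf_neq0.
(* The inner product of [a] and [b] is [- r ^+ 2 / 2], so their cross product is [s3 / 2 * r ^+ 2]
   up to sign, again the orientation. *)
have : (a1 * b2 - a2 * b1 - s3 / 2 * r ^+ 2) * (a1 * b2 - a2 * b1 + s3 / 2 * r ^+ 2) = 0.
  have -> : (a1 * b2 - a2 * b1 - s3 / 2 * r ^+ 2) * (a1 * b2 - a2 * b1 + s3 / 2 * r ^+ 2) =
    (a1 ^+ 2 + a2 ^+ 2) * (b1 ^+ 2 + b2 ^+ 2) - (a1 * b1 + a2 * b2) ^+ 2
    - s3 ^+ 2 * (r ^+ 2) ^+ 2 / 4 by field.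
  by rewrite s3_sqr eab oab r2; field.
have bE1 : b1 * r ^+ 2 = - a2 * (a1 * b2 - a2 * b1) + a1 * (a1 * b1 + a2 * b2).
  by rewrite r2; ring.
have bE2 : b2 * r ^+ 2 = a1 * (a1 * b2 - a2 * b1) + a2 * (a1 * b1 + a2 * b2).
  by rewrite r2; ring.
rewrite oab -r2 in bE1 bE2.
have rr0 : r ^+ 2 != 0 by rewrite expf_neq0.
have k1 s : r * (- (a1 / r) / 2 + s / 2 * (a2 / r)) = - a1 / 2 + s / 2 * a2 by field.
have k2 s : r * (- (a2 / r) / 2 + s / 2 * (a1 / r)) = - a2 / 2 + s / 2 * a1 by field.
have k3 : r * (- (a1 / r) / 2 - s3 / 2 * (a2 / r)) = - a1 / 2 - s3 / 2 * a2 by field.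
have k4 : r * (- (a2 / r) / 2 - s3 / 2 * (a1 / r)) = - a2 / 2 - s3 / 2 * a1 by field.
rewrite k1 k2 k3 k4.
have -> : r * (a1 / r) = a1 by rewrite mulrC divfK.
have -> : r * (a2 / r) = a2 by rewrite mulrC divfK.
move/eqP; rewrite mulf_eq0 => /orP[/eqP|/eqP] /eqP.
- rewrite subr_eq0 => /eqP h; rewrite h in bE1 bE2.
  have -> : b1 = - a1 / 2 - s3 / 2 * a2 by apply: (mulIf rr0); rewrite bE1; field.
  have -> : b2 = - a2 / 2 + s3 / 2 * a1 by apply: (mulIf rr0); rewrite bE2; field.
  move=> x; rewrite !inE -!orbA => /or4P[]/eqP ->;
    [exact: Or41|exact: Or42|exact: Or43|apply: Or44].
  by congr (_, _); field.
- rewrite addr_eq0 => /eqP h; rewrite h in bE1 bE2.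
  have -> : b1 = - a1 / 2 + s3 / 2 * a2 by apply: (mulIf rr0); rewrite bE1; field.
  have -> : b2 = - a2 / 2 - s3 / 2 * a1 by apply: (mulIf rr0); rewrite bE2; field.
  move=> x; rewrite !inE -!orbA => /or4P[]/eqP ->;
    [exact: Or41|exact: Or42|exact: Or44|apply: Or43].
  by congr (_, _); field.
Qed.

(** For a unit vector [t], the coordinates of [x] in the frame of [t] and its quarter turn. *)
Definition rot (t : R * R) x : plane R :=
  (t.1 * x.1 + t.2 * x.2, - t.2 * x.1 + t.1 * x.2).

Lemma sector_sqr_in (p q : R) : q <= s3 * p -> - q <= s3 * p ->
  sector_sqr (p, q) = p ^+ 2.
Proof. by move=> h1 h2; rewrite /sector_sqr/= ler_norml h1 lerNl h2. Qed.

(* Among the three directions at 120 degrees, the one with the largest p has the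
   point in its sector. *)
Lemma sector_cover (p q m : R) :
  let p2 := - p / 2 + s3 / 2 * q in let q2 := - q / 2 - s3 / 2 * p in
  let p3 := - p / 2 - s3 / 2 * q in let q3 := - q / 2 + s3 / 2 * p in
  0 <= m -> [|| m <= p, m <= p2 | m <= p3] ->
  m ^+ 2 <= sector_sqr (p, q) + sector_sqr (p2, q2) + sector_sqr (p3, q3).
Proof.
move=> p2 q2 p3 q3 m0 h.
have [S1 S2 S3] := And3 (sector_sqr_ge0 (p, q)) (sector_sqr_ge0 (p2, q2))
  (sector_sqr_ge0 (p3, q3)).
have le_sqr z : m <= z -> m ^+ 2 <= z ^+ 2 by move=> mz; rewrite lerXn2r ?nnegrE ?(le_trans m0).
have conclude z : m <= z -> z ^+ 2 <= sector_sqr (p, q) + sector_sqr (p2, q2) +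
    sector_sqr (p3, q3) -> m ^+ 2 <= sector_sqr (p, q) + sector_sqr (p2, q2) +
    sector_sqr (p3, q3).
  by move=> /le_sqr; exact: le_trans.
have s30 := s3_gt0; have s33 := s3_sqr.
(* [p2 <= p] and [p3 <= p] together say that [|q| <= s3 * p], which is the sector condition; the
   other two directions are alike. *)
have [p21|/ltW p12] := leP p2 p; have [p32|/ltW p23] := leP p3 p2;
    have [p31|/ltW p13] := leP p3 p.
- apply: (conclude p); first by case/or3P: h => // /le_trans; apply.
  rewrite (@sector_sqr_in p q); [lra| |]; move: p21 p31; rewrite /p2 /p3; nra.
- have p31 := le_trans p32 p21.
  apply: (conclude p); first by case/or3P: h => // /le_trans; apply.
  rewrite (@sector_sqr_in p q); [lra| |]; move: p21 p31; rewrite /p2 /p3; nra.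
- apply: (conclude p); first by case/or3P: h => // /le_trans; apply.
  rewrite (@sector_sqr_in p q); [lra| |]; move: p21 p31; rewrite /p2 /p3; nra.
- apply: (conclude p3); first by case/or3P: h => // /le_trans; apply.
  rewrite (@sector_sqr_in p3 q3); [lra| |]; move: p23 p13; rewrite /q3 /p2 /p3; nra.
- apply: (conclude p2); first by case/or3P: h => // /le_trans; apply.
  rewrite (@sector_sqr_in p2 q2); [lra| |]; move: p32 p12; rewrite /q2 /p2 /p3; nra.
- apply: (conclude p2); first by case/or3P: h => // /le_trans; apply.
  rewrite (@sector_sqr_in p2 q2); [lra| |]; move: p32 p12; rewrite /q2 /p2 /p3; nra.
- have p13 := le_trans p12 p23.
  apply: (conclude p3); first by case/or3P: h => // /le_trans; apply.
  rewrite (@sector_sqr_in p3 q3); [lra| |]; move: p23 p13; rewrite /q3 /p2 /p3; nra.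
- apply: (conclude p3); first by case/or3P: h => // /le_trans; apply.
  rewrite (@sector_sqr_in p3 q3); [lra| |]; move: p23 p13; rewrite /q3 /p2 /p3; nra.
Qed.

Variable P : probability (plane R) R.
Hypothesis PU : uniform_on_disc P.

Lemma mean_sector_sqr_rot (t : R * R) : t.1 ^+ 2 + t.2 ^+ 2 = 1 ->
  (\int[P]_x (sector_sqr (rot t x))%:E <= (13 * s3 / (60 * pi))%:E)%E.
Proof.
move=> t12; have cs : t.1 ^+ 2 + (- t.2) ^+ 2 = 1 by rewrite sqrrN.
have ms : measurable_fun setT (fun x : plane R => (sector_sqr x)%:E).
  by apply/measurable_EFinP; exact: measurable_sector_sqr.
rewrite (le_trans _ (mean_sector_sqr PU))//.
rewrite -(ge0_integral_uniform_rotation PU cs ms); last first.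
  by move=> x; rewrite lee_fin sector_sqr_ge0.
rewrite le_eqVlt; apply/orP; left; apply/eqP; apply: eq_integral => x _ /=.
by rewrite mulNr opprK.
Qed.

Lemma measurable_sector_sqr_rot (t : R * R) :
  measurable_fun setT (fun x => (sector_sqr (rot t x))%:E).
Proof.
apply/measurable_EFinP; apply: measurableT_comp; first exact: measurable_sector_sqr.
by apply: measurable_fun_pair; apply: measurable_funD; apply: measurable_funM.
Qed.

Lemma distortion_center_triangle alpha :
  is_center_with_equilateral_triangle 0 alpha ->
  (2^-1%:E <= distortion P alpha + (13 * s3 / (20 * pi))%:E)%E.
Proof.
move=> /center_triangle0[r [t1 [t2 [r0 t12 alphaE]]]].
pose u1 : R * R := (t1, t2).
pose u2 : R * R := (- t1 / 2 - s3 / 2 * t2, - t2 / 2 + s3 / 2 * t1).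
pose u3 : R * R := (- t1 / 2 + s3 / 2 * t2, - t2 / 2 - s3 / 2 * t1).
have u1n : u1.1 ^+ 2 + u1.2 ^+ 2 = 1 by [].
have u2n : u2.1 ^+ 2 + u2.2 ^+ 2 = 1.
  rewrite -t12 /u2/=.
  have -> : (- t1 / 2 - s3 / 2 * t2) ^+ 2 + (- t2 / 2 + s3 / 2 * t1) ^+ 2 =
    (1 + s3 ^+ 2) / 4 * (t1 ^+ 2 + t2 ^+ 2) by field.
  by rewrite s3_sqr; field.
have u3n : u3.1 ^+ 2 + u3.2 ^+ 2 = 1.
  rewrite -t12 /u3/=.
  have -> : (- t1 / 2 + s3 / 2 * t2) ^+ 2 + (- t2 / 2 - s3 / 2 * t1) ^+ 2 =
    (1 + s3 ^+ 2) / 4 * (t1 ^+ 2 + t2 ^+ 2) by field.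
  by rewrite s3_sqr; field.
pose f u x := (sector_sqr (rot u x))%:E.
have f0 u x : (0 <= f u x)%E by rewrite lee_fin sector_sqr_ge0.
have mf u : measurable_fun setT (f u) by exact: measurable_sector_sqr_rot.
have mN := measurable_sqdist_set alpha.
have N0 := sqdist_set_ge0 alpha.
(* By rotation invariance the three sectors have the same bound, whence the factor 3. *)
have le3 : (\int[P]_x f u1 x + \int[P]_x f u2 x + \int[P]_x f u3 x <=
    (13 * s3 / (20 * pi))%:E)%E.
  have -> : 13 * s3 / (20 * pi) = 13 * s3 / (60 * pi) + 13 * s3 / (60 * pi) +
      13 * s3 / (60 * pi) :> R.
    by move: (@pi_gt0 R); move: (@pi R) => p p0; field; rewrite gt_eqF.
  by rewrite !EFinD; apply: leeD; [apply: leeD|]; exact: mean_sector_sqr_rot.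
rewrite (le_trans _ (leeD2l _ le3))//.
have m12 : measurable_fun setT (fun x => (f u1 x + f u2 x)%E) by exact: emeasurable_funD.
have m123 : measurable_fun setT (fun x => (f u1 x + f u2 x + f u3 x)%E).
  exact: emeasurable_funD.
have p12 x : (0 <= f u1 x + f u2 x)%E by rewrite adde_ge0.
have p123 x : (0 <= f u1 x + f u2 x + f u3 x)%E by rewrite adde_ge0.
rewrite -[distortion P alpha]/(\int[P]_x sqdist_set alpha x)%E.
rewrite -(ge0_integralD P measurableT (fun x _ => f0 u1 x) (mf u1) (fun x _ => f0 u2 x) (mf u2)).
rewrite -(ge0_integralD P measurableT (fun x _ => p12 x) m12 (fun x _ => f0 u3 x) (mf u3)).
rewrite -(ge0_integralD P measurableT (fun x _ => N0 x) mN (fun x _ => p123 x) m123).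
rewrite -(mean_sqnorm PU); apply: ge0_le_integral => //.
- by move=> x _; rewrite lee_fin addr_ge0 ?sqr_ge0.
- by apply/measurable_EFinP; exact: measurable_sqnorm.
- exact: emeasurable_funD.
move=> x _; rewrite /f -!EFinD.
set S := (_ + _ + _ in leRHS).
suff : ((x.1 ^+ 2 + x.2 ^+ 2 - S)%:E <= sqdist_set alpha x)%E.
  by rewrite EFinB leeBlDr.
pose p : R := t1 * x.1 + t2 * x.2; pose q : R := - t2 * x.1 + t1 * x.2.
have SE m : 0 <= m -> [|| m <= p, m <= - p / 2 + s3 / 2 * q | m <= - p / 2 - s3 / 2 * q] ->
    m ^+ 2 <= S.
  move=> m0 h; rewrite (le_trans (sector_cover m0 h))// /S /rot /u1 /u2 /u3/=.
  rewrite le_eqVlt; apply/orP; left; apply/eqP; rewrite /p /q.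
  by congr (sector_sqr _ + sector_sqr (_, _) + sector_sqr (_, _)); field.
have S0 : 0 <= S by rewrite !addr_ge0 ?sector_sqr_ge0.
(* The three alternatives are the inner products of [x] with [u1], [u2], [u3]. For [m >= 0] use
   [2 r m <= r^2 + m^2] and [m^2 <= S]; for [m < 0] the left side is negative. *)
have key m : [|| m <= p, m <= - p / 2 + s3 / 2 * q | m <= - p / 2 - s3 / 2 * q] ->
    2 * r * m <= r ^+ 2 + S.
  move=> h; have [m0|m0] := leP 0 m; last by nra.
  by have := SE m m0 h; have := sqr_ge0 (r - m); nra.
apply: le_bigmin_pinfty => a /alphaE ha; rewrite lee_fin enorm_subr_sqr.
have rr u : u.1 ^+ 2 + u.2 ^+ 2 = 1 -> 2 * r * (u.1 * x.1 + u.2 * x.2) <= r ^+ 2 + S ->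
    x.1 ^+ 2 + x.2 ^+ 2 - S <= (x.1 - r * u.1) ^+ 2 + (x.2 - r * u.2) ^+ 2.
  move=> un h.
  have -> : (x.1 - r * u.1) ^+ 2 + (x.2 - r * u.2) ^+ 2 = x.1 ^+ 2 + x.2 ^+ 2 +
    r ^+ 2 * (u.1 ^+ 2 + u.2 ^+ 2) - 2 * r * (u.1 * x.1 + u.2 * x.2) by ring.
  by rewrite un mulr1; lra.
case: ha => ->.
- by rewrite /= !subr0 gerBl.
- by apply: (rr u1) => //; apply: key; rewrite lexx.
- apply: (rr u2) => //; apply: key; apply/or3P; apply: Or32.
  by rewrite le_eqVlt; apply/orP; left; apply/eqP; rewrite /p /q /u2/=; field.
- apply: (rr u3) => //; apply: key; apply/or3P; apply: Or33.
  by rewrite le_eqVlt; apply/orP; left; apply/eqP; rewrite /p /q /u3/=; field.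
Qed.

End Triangle.

(** * Existence and uniqueness of the optimal radius *)

Section Existence.
Import numFieldNormedType.Exports.
Variable R : realType.
Variable P : probability (plane R) R.
Hypothesis PU : uniform_on_disc P.
Implicit Types (alpha beta : {fset plane R}).
Local Notation D := (@unit_disc R).

(** [P] lives on the disc, so a comparison there is enough. *)
Lemma ge0_le_integral_uniform (f g : plane R -> \bar R) :
  measurable_fun setT f -> measurable_fun setT g ->
  (forall x, (0 <= f x)%E) -> (forall x, (0 <= g x)%E) ->
  (forall x, D x -> (f x <= g x)%E) -> (\int[P]_x f x <= \int[P]_x g x)%E.
Proof.
move=> mf mg f0 g0 fg.
rewrite (ge0_integral_uniform PU mf f0) (ge0_integral_uniform PU mg g0).
apply: lee_wpmul2l; first by rewrite lee_fin invr_ge0 pi_ge0.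
by apply: ge0_le_integral => //;
  [exact: measurable_unit_disc|exact: measurable_funTS|exact: measurable_funTS].
Qed.

Lemma unit_disc_itv (x : plane R) : D x -> `|x.1| <= 1 /\ `|x.2| <= 1.
Proof.
have sq1 (z : R) : z ^+ 2 <= 1 -> `|z| <= 1.
  by move=> z1; rewrite -(@expr_le1 _ 2)// real_normK ?num_real.
rewrite /unit_disc/= => h.
by split; apply: sq1; rewrite (le_trans _ h)// ?lerDl ?lerDr sqr_ge0.
Qed.

Lemma distortion_fin alpha a : a \in alpha -> distortion P alpha \is a fin_num.
Proof.
move=> aalpha; rewrite ge0_fin_numE; last first.
  by apply: integral_ge0 => x _; exact: sqdist_set_ge0.
(* By the parallelogram law |x - a|^2 is at most 2 |x|^2 + 2 |a|^2, and |x| is at most 1 on the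
   disc. *)
pose M : R := 2 + a.1 ^+ 2 * 2 + a.2 ^+ 2 * 2 + 2.
apply: (@le_lt_trans _ _ (\int[P]_x cst M%:E x)%E); last first.
  by rewrite integral_cst//= probability_setT mule1 ltry.
have M0 : 0 <= M by rewrite /M; have := sqr_ge0 a.1; have := sqr_ge0 a.2; nra.
apply: ge0_le_integral_uniform => //.
- exact: measurable_sqdist_set.
- exact: sqdist_set_ge0.
move=> x Dx; apply: (le_trans (bigmin_pinfty_le _ aalpha)).
rewrite lee_fin enorm_subr_sqr /M; move: Dx; rewrite /unit_disc/=.
by have := sqr_ge0 (x.1 + a.1); have := sqr_ge0 (x.2 + a.2); nra.
Qed.

(** Row vectors of first and second coordinates give a normed parameter space in which a product of
    segments is compact; coinciding points account for smaller sets. *)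
Definition pts (v : 'rV[R]_4 * 'rV[R]_4) : {fset plane R} :=
  [fset ((v.1 ord0 i, v.2 ord0 i) : plane R) | i : 'I_4]%fset.

Lemma card_pts v : (#|` pts v| <= 4)%N.
Proof. by rewrite (leq_trans (leq_imfset_card _ _ _))//= size_enum_ord. Qed.

Lemma mem_pts (v : 'rV[R]_4 * 'rV[R]_4) i : ((v.1 ord0 i, v.2 ord0 i) : plane R) \in pts v.
Proof. exact: in_imfset. Qed.

Definition box : set ('rV[R]_4 * 'rV[R]_4) :=
  [set u : 'rV[R]_4 | forall i, `[-1, 1]%classic (u ord0 i)] `*`
  [set u : 'rV[R]_4 | forall i, `[-1, 1]%classic (u ord0 i)].

Lemma compact_box : compact box.
Proof.
have c : compact [set u : 'rV[R]_4 | forall i, `[-1, 1]%classic (u ord0 i)].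
  by apply: (@rV_compact R 4 (fun=> `[-1, 1]%classic)) => _; exact: segment_compact.
exact: compact_setX.
Qed.

Lemma normr_row_le (u : 'rV[R]_4) i : `|u ord0 i| <= `|u|.
Proof.
by rewrite [leRHS]mx_normrE; apply/bigmax_geP; right; exists (ord0, i).
Qed.

Lemma distortion_pts_lip v w (e : R) : box v -> box w -> `|v - w| <= e ->
  (distortion P (pts w) <= distortion P (pts v) + (8 * e)%:E)%E.
Proof.
move=> [v1 v2] [w1 w2] vwe.
have e0 : 0 <= e by rewrite (le_trans _ vwe).
rewrite (_ : (8 * e)%:E = \int[P]_x cst (8 * e)%:E x)%E; last first.
  by rewrite integral_cst//= probability_setT mule1.
have c0 (x : plane R) : setT x -> (0 <= cst (8 * e)%:E x)%E by rewrite lee_fin mulr_ge0.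
rewrite -[distortion P (pts v)]/(\int[P]_x sqdist_set (pts v) x)%E.
rewrite -(ge0_integralD P measurableT (fun x _ => sqdist_set_ge0 (pts v) x)
  (measurable_sqdist_set (pts v)) c0 (measurable_cst _)).
apply: ge0_le_integral_uniform => //.
- exact: measurable_sqdist_set.
- by apply: emeasurable_funD => //; exact: measurable_sqdist_set.
- exact: sqdist_set_ge0.
- by move=> x; rewrite adde_ge0 ?sqdist_set_ge0// lee_fin mulr_ge0.
move=> x /unit_disc_itv[]; rewrite !ler_norml => /andP[x1 x2] /andP[x3 x4].
suff : (sqdist_set (pts w) x - (8 * e)%:E <= sqdist_set (pts v) x)%E.
  by rewrite leeBlDr.
apply: le_bigmin_pinfty => _ /imfsetP[i _ ->].
suff : (sqdist_set (pts w) x <=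
    (enorm (x - (v.1 ord0 i, v.2 ord0 i)) ^+ 2)%:E + (8 * e)%:E)%E.
  by rewrite leeBlDr.
apply: (le_trans (bigmin_pinfty_le _ (mem_pts w i))).
rewrite -EFinD lee_fin !enorm_subr_sqr/=.
have : `|v.1 ord0 i - w.1 ord0 i| <= e.
  have := normr_row_le (v - w).1 i; rewrite !mxE => /le_trans; apply.
  by rewrite (le_trans _ vwe)// prod_normE le_max lexx.
have : `|v.2 ord0 i - w.2 ord0 i| <= e.
  have := normr_row_le (v - w).2 i; rewrite !mxE => /le_trans; apply.
  by rewrite (le_trans _ vwe)// prod_normE le_max lexx orbT.
have := v1 i; have := v2 i; have := w1 i; have := w2 i; rewrite /= !in_itv/=.
move: (v.1 _ _) (v.2 _ _) (w.1 _ _) (w.2 _ _) => a b c d.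
move=> /andP[? ?] /andP[? ?] /andP[? ?] /andP[? ?].
rewrite !ler_norml => /andP[? ?] /andP[? ?].
move: x1 x2 x3 x4; move: x.1 x.2 => y z *.
(* This product is [(y - c)^2 - (y - a)^2], and [|2 y - a - c|] is at most 4 in the box. The two
   coordinates together give the constant 8. *)
have : (a - c) * (2 * y - a - c) <= 4 * e by nra.
have : (b - d) * (2 * z - b - d) <= 4 * e by nra.
by move=> *; lra.
Qed.

Lemma pts_fin v : distortion P (pts v) \is a fin_num.
Proof. exact: distortion_fin (mem_pts v ord0). Qed.

(** The Lipschitz bound makes the finite distortion continuous on the compact box, where it attains
    its minimum. *)
Lemma exists_min_box : exists2 v, box v &
  forall w, box w -> (distortion P (pts v) <= distortion P (pts w))%E.
Proof.
pose G v := fine (distortion P (pts v)).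
have box0 : box !=set0.
  by exists (0, 0); split => i /=; rewrite mxE in_itv/= oppr_le0 ler01.
have GE v : distortion P (pts v) = (G v)%:E by rewrite /G fineK// pts_fin.
have Glip v w e : box v -> box w -> `|v - w| <= e -> `|G v - G w| <= 8 * e.
  move=> bv bw vwe; rewrite ler_distlC; apply/andP; split.
    have := distortion_pts_lip bw bv; rewrite distrC => /(_ _ vwe).
    by rewrite !GE -EFinD lee_fin => ?; rewrite lerBlDr.
  have := distortion_pts_lip bv bw vwe.
  by rewrite !GE -EFinD lee_fin.
have cG : {within box, continuous G}.
  apply/subspace_continuousP => v bv; apply/cvgrPdist_lt => e e0.
  near=> w.
  have bw : box w by near: w; exact: withinT.
  apply: (@le_lt_trans _ _ (8 * (e / 9))); last by lra.
  apply: Glip => //; apply: ltW; near: w.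
  have e9 : 0 < e / 9 by exact: divr_gt0.
  by apply: cvg_within; exact: (nbhs_ball_norm v (PosNum e9)).
have [v bv vmin] := compact_EVT_min box0 compact_box cG.
exists v; first by rewrite inE in bv.
by move=> w bw; rewrite !GE lee_fin vmin// inE.
Unshelve. all: by end_near. Qed.

Lemma exists_optimal_means : exists alpha, optimal_means P 4 alpha.
Proof.
have [v bv vmin] := exists_min_box.
exists (pts v); split; first exact: card_pts.
apply/eqP; rewrite eq_le; apply/andP; split; last first.
  by apply: ereal_inf_lbound; exists (pts v) => //=; exact: card_pts.
apply: le_ereal_inf_tmp => _ [alpha /= alpha4 <-].
pose clamp (t : R) : R := Num.max (-1) (Num.min 1 t).
have clamp_itv t : -1 <= clamp t <= 1.
  by rewrite /clamp le_max lexx ge_max ge_min lexx/= andbT; lra.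
have clamp_sqr (y t : R) : `|y| <= 1 -> (y - clamp t) ^+ 2 <= (y - t) ^+ 2.
  rewrite ler_norml => /andP[y1 y2]; rewrite /clamp.
  have [t1|t1] := leP 1 t.
    by rewrite max_r; [nra|lra].
  by have [t2|t2] := leP t (-1); nra.
(* A set with fewer than four points is padded with the origin; extra points can only lower the
   distance. *)
pose p i := nth (0 : plane R) alpha i.
pose w : 'rV[R]_4 * 'rV[R]_4 :=
  (\row_(i < 4) clamp (p i).1, \row_(i < 4) clamp (p i).2).
have bw : box w by split => i /=; rewrite mxE in_itv/=; exact: clamp_itv.
apply: (le_trans (vmin _ bw)).
apply: ge0_le_integral_uniform; [exact: measurable_sqdist_set|
  exact: measurable_sqdist_set|exact: sqdist_set_ge0|exact: sqdist_set_ge0|].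
move=> x /unit_disc_itv[x1 x2].
apply: le_bigmin_pinfty => a aalpha.
have ia : (index a alpha < 4)%N.
  by rewrite (leq_trans _ alpha4)// index_mem.
apply: (le_trans (bigmin_pinfty_le _ (mem_pts w (Ordinal ia)))).
rewrite lee_fin !enorm_subr_sqr/= !mxE/= /p nth_index//.
by rewrite lerD// clamp_sqr.
Qed.

End Existence.

(** * The optimal squares and the value of the quantization error *)

Section OptimalSquares.
Variable R : realType.
Variable P : probability (plane R) R.
Hypothesis PU : uniform_on_disc P.
Implicit Types (alpha : {fset plane R}).

Definition opt_radius : R := 4 * Num.sqrt 2 / (3 * pi).
Local Notation K := opt_radius.

Lemma opt_radius_gt0 : 0 < K.
Proof. by rewrite divr_gt0 ?mulr_gt0 ?sqrtr_gt0 ?pi_gt0. Qed.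

Lemma opt_radius_sqr : K ^+ 2 = 32 / (9 * pi ^+ 2).
Proof.
rewrite /K expr_div_n exprMn sqr_sqrtr//.
by move: (@pi_gt0 R); move: (@pi R) => p p0; field; rewrite gt_eqF.
Qed.

(** It turns the distortion of a square of radius [r] into [2^-1 - K^2 + (r - K)^2]. *)
Lemma opt_radius_double : 8 * Num.sqrt 2 / (3 * pi) = 2 * K.
Proof.
rewrite /K; move: (Num.sqrt 2) (@pi_gt0 R); move: (@pi R) => p s p0.
by field; rewrite gt_eqF.
Qed.

Definition opt_square (t1 t2 : R) : {fset plane R} :=
  [fset z in [:: (K * t1, K * t2) : plane R; (- (K * t2), K * t1);
                 (- (K * t1), - (K * t2)); (K * t2, - (K * t1))]]%fset.

Lemma opt_squareE t1 t2 x : (x \in opt_square t1 t2) =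
  [|| x == (K * t1, K * t2), x == (- (K * t2), K * t1),
      x == (- (K * t1), - (K * t2)) | x == (K * t2, - (K * t1))].
Proof. by rewrite !inE orbF. Qed.

Lemma card_opt_square t1 t2 : (#|` opt_square t1 t2| <= 4)%N.
Proof. by rewrite card_fseq (leq_trans (size_undup _)). Qed.

Lemma distortion_opt_square t1 t2 : t1 ^+ 2 + t2 ^+ 2 = 1 ->
  distortion P (opt_square t1 t2) = (2^-1 - K ^+ 2)%:E.
Proof.
move=> t12; rewrite (distortion_square PU opt_radius_gt0 t12 (opt_squareE t1 t2)).
by congr (_%:E); rewrite opt_radius_double; ring.
Qed.

Lemma quantization_error_le : (quantization_error P 4 <= (2^-1 - K ^+ 2)%:E)%E.
Proof.
have t12 : (1 : R) ^+ 2 + 0 ^+ 2 = 1 by ring.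
rewrite -(distortion_opt_square t12); apply: ereal_inf_lbound.
by exists (opt_square 1 0) => //=; exact: card_opt_square.
Qed.

(** Cleared of denominators this is [13 sqrt 3 pi < 640 / 9], about 70.74 against 71.11; the bounds
    1.74 and 3.141594 leave enough room. *)
Lemma center_triangle_gap : 13 * Num.sqrt 3 / (20 * pi) < K ^+ 2.
Proof.
rewrite opt_radius_sqr.
have s3 : Num.sqrt 3 < 174 / 100 :> R.
  have : Num.sqrt 3 ^+ 2 = 3 :> R by rewrite sqr_sqrtr.
  by have := sqrtr_ge0 (3 : R); move: (Num.sqrt 3) => s s0 s3; nra.
have := @pi_lt R; have := @pi_gt0 R; move: s3; move: (Num.sqrt 3) (@pi R) => s p.
move=> s3 p0 ph.
rewrite ltr_pdivrMr ?mulr_gt0//.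
have -> : 32 / (9 * p ^+ 2) * (20 * p) = 640 / 9 / p by field; rewrite gt_eqF.
rewrite ltr_pdivlMr//; nra.
Qed.

Lemma optimal_square alpha : optimal_means P 4 alpha ->
  is_square_centered_at 0 alpha \/
    is_center_with_equilateral_triangle 0 alpha ->
  [/\ is_square alpha, distortion P alpha = (2^-1 - K ^+ 2)%:E &
    forall x, x \in alpha -> x.1 ^+ 2 + x.2 ^+ 2 = K ^+ 2].
Proof.
move=> [_ opt] [sq|tri]; last first.
  have := distortion_center_triangle PU tri; rewrite opt => h.
  have := le_trans h (leeD2r _ quantization_error_le).
  rewrite -EFinD lee_fin => {}h.
  by have := center_triangle_gap; lra.
have [a [b [c [d [sqr _ alphaE]]]]] := sq.
have [r [t1 [t2 [r0 t12 mem]]]] := square_centered0 sq.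
have dE := distortion_square PU r0 t12 mem.
(* Optimality bounds [2^-1 - K^2 + (r - K)^2] by [2^-1 - K^2], so the square of [r - K] vanishes. *)
have rK : r = K.
  have := quantization_error_le; rewrite -opt dE lee_fin opt_radius_double => h.
  by apply/eqP; rewrite -subr_eq0 -sqrf_eq0 eq_le sqr_ge0 andbT; nra.
split; first by exists a, b, c, d.
  by rewrite dE rK opt_radius_double; congr (_%:E); ring.
move=> x; rewrite mem -[K ^+ 2]mulr1 -t12 rK.
by case/or4P => /eqP -> /=; ring.
Qed.

Lemma opt_value_approx :
  `|2^-1 - K ^+ 2 - 139747%:R / 10%:R ^+ 6| < 10%:R ^- 6.
Proof.
have -> : 139747%:R = 139%:R * 1000%:R + 747%:R :> R.
  by rewrite -natrM -natrD; congr (_%:R); vm_compute.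
rewrite opt_radius_sqr.
have := @pi_lt R; have := @pi_gt R; have := @pi_gt0 R; move: (@pi R) => p p0 pl pu.
have p2 : 0 < 9 * p ^+ 2 by rewrite mulr_gt0// exprn_gt0.
have pp1 : (3 + 141 / 10 ^+ 3 + 591 / 10 ^+ 6) ^+ 2 < p ^+ 2.
  by rewrite ltr_pXn2r// nnegrE; lra.
have pp2 : p ^+ 2 < (3 + 141 / 10 ^+ 3 + 594 / 10 ^+ 6) ^+ 2.
  by rewrite ltr_pXn2r// nnegrE; lra.
(* The squared radius lies between 0.360252 and 0.360254, which are 1/2 minus the ends of the
   required interval. *)
have h1 : 32 / (9 * p ^+ 2) < 360 / 10 ^+ 3 + 254 / 10 ^+ 6.
  by rewrite ltr_pdivrMr//; lra.
have h2 : 360 / 10 ^+ 3 + 252 / 10 ^+ 6 < 32 / (9 * p ^+ 2).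
  by rewrite ltr_pdivlMr//; lra.
by rewrite ltr_norml; apply/andP; split; lra.
Qed.

(** Countably many finite sets have countably many first coordinates, but those of the rotated
    squares cover [0, K], which has positive measure. *)
Lemma opt_squares_uncountable : (forall t1 t2, t1 ^+ 2 + t2 ^+ 2 = 1 ->
    optimal_means P 4 (opt_square t1 t2)) ->
  ~ countable [set alpha | optimal_means P 4 alpha].
Proof.
move=> opt cnt.
pose F alpha : set R := [set x.1 | x in [set` alpha]].
have cF : countable (\bigcup_(alpha in [set alpha | optimal_means P 4 alpha]) F alpha).
  apply: bigcup_countable => // alpha _; apply: finite_set_countable.
  by apply: finite_image; exact: finite_fset.
have : countable `[0, K]%classic.
  apply: sub_countable cF; apply: subset_card_le => y /=.
  rewrite in_itv/= => /andP[y0 yK].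
  pose t := y / K; have Kn0 : K != 0 by rewrite gt_eqF ?opt_radius_gt0.
  have t1 : t ^+ 2 <= 1.
    have t0 : 0 <= t by exact: divr_ge0 y0 (ltW opt_radius_gt0).
    by rewrite expr_le1// ler_pdivrMr ?mul1r// opt_radius_gt0.
  have tt : t ^+ 2 + Num.sqrt (1 - t ^+ 2) ^+ 2 = 1.
    by rewrite sqr_sqrtr; [ring|rewrite subr_ge0].
  exists (opt_square t (Num.sqrt (1 - t ^+ 2))); first exact: opt.
  exists (K * t, K * Num.sqrt (1 - t ^+ 2)); first by rewrite /= opt_squareE eqxx.
  by rewrite /= /t mulrC divfK.
move=> /countable_lebesgue_measure0.
rewrite lebesgue_measure_itv/= lte_fin opt_radius_gt0 -EFinB subr0 => -[] /eqP.
by rewrite gt_eqF ?opt_radius_gt0.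
Qed.

End OptimalSquares.

Theorem theorem2p9p1 (R : realType) (P : probability (plane R) R)
    (P_uniform : uniform_on_disc P)
    (shape : forall alpha : {fset plane R}, optimal_means P 4 alpha ->
       is_square_centered_at 0 alpha \/
       is_center_with_equilateral_triangle 0 alpha) :
  [/\ ~ countable [set alpha : {fset plane R} | optimal_means P 4 alpha],
      (`|quantization_error P 4 - (139747%:R / 10%:R ^+ 6)%:E|
         < (10%:R ^- 6)%:E)%E &
      forall alpha : {fset plane R}, optimal_means P 4 alpha ->
        is_square alpha /\
        (forall x : plane R, x \in alpha ->
           x.1 ^+ 2 + x.2 ^+ 2 = 32%:R / (9%:R * pi ^+ 2))].
Proof.
have opt_sq alpha (opt : optimal_means P 4 alpha) :=
  optimal_square P_uniform opt (shape alpha opt).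
(* An optimal set has to exist before [shape] says anything about the infimum. *)
have VE : quantization_error P 4 = (2^-1 - opt_radius R ^+ 2)%:E.
  have [alpha opt] := exists_optimal_means P_uniform.
  by have [_ <- _] := opt_sq alpha opt; case: opt => _ ->.
split.
- apply: opt_squares_uncountable => t1 t2 t12; split; first exact: card_opt_square.
  by rewrite VE distortion_opt_square.
- by rewrite VE -EFinB /abse lte_fin; exact: opt_value_approx.
- move=> alpha opt; have [sq _ mem] := opt_sq alpha opt; split => // x xalpha.
  by rewrite -opt_radius_sqr; exact: mem.
Qed.
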